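(* Let $(\mathcal{A},\varphi)$ be a non-commutative probability space. Suppose that $\mathfrak{p}\in\mathcal{A}$ is free Poisson with rate $1$ and is freely independent of $\{\mathfrak{a}_1,\ldots,\mathfrak{a}_k\}\subset\mathcal{A}$. Then $\mathfrak{p}\mathfrak{a}_1,\ldots,\mathfrak{p}\mathfrak{a}_k$ are freely independent if and only if $$\varphi(\mathfrak{a}_{i_1}\cdots\mathfrak{a}_{i_m})=0$$ for all $m\ge2$ and all $i_1,\ldots,i_m\in\{1,\ldots,k\}$ that are not all equal. In particular, if $(\mathcal{A},\varphi)$ is a $*$-probability space with $\varphi$ faithful, all the $\mathfrak{a}_j$ are self-adjoint, and $\mathfrak{p}\mathfrak{a}_1,\ldots,\mathfrak{p}\mathfrak{a}_k$ are freely independent, then $\mathfrak{a}_r\mathfrak{a}_s=0$ for all $r\ne s$.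
   Context: A non-commutative probability space is a pair $(\mathcal{A},\varphi)$ with $\mathcal{A}$ a unital algebra over $\mathbb{C}$ and $\varphi:\mathcal{A}\to\mathbb{C}$ linear with $\varphi(\mathbf{1}_{\mathcal{A}})=1$. It is a $*$-probability space if $\mathcal{A}$ is a $*$-algebra and $\varphi(a^*a)\ge0$ for all $a$; $\varphi$ is faithful if $\varphi(a^*a)=0$ only for $a=0$. Unital subalgebras $(\mathcal{A}_i)_{i\in I}$ are freely independent (free) if $\varphi(a_1\cdots a_n)=0$ whenever $n\ge1$, $a_j\in\mathcal{A}_{i_j}$, $\varphi(a_j)=0$ for all $j$, and $i_1\ne i_2,\ldots,i_{n-1}\ne i_n$. Elements (or sets of elements) are free if the unital subalgebras they generate are free. Free cumulants $\kappa_n:\mathcal{A}^n\to\mathbb{C}$ are the multilinear functionals determined by $\varphi(a_1\cdots a_n)=\sum_{\pi\in NC(n)}\prod_{V\in\pi}\kappa_{|V|}(a_{i}:i\in V)$ (indices in each block in increasing order), where $NC(n)$ is the set of non-crossing partitions of $\{1,\ldots,n\}$; $\kappa_n(a):=\kappa_n(a,\ldots,a)$. $\mathfrak{p}\in\mathcal{A}$ is free Poisson with rate $\lambda>0$ and jump size $\alpha>0$ if $\kappa_n(\mathfrak{p})=\lambda\alpha^n$ for all $n\ge1$; it is free Poisson with rate $\lambda$ if this holds for some $\alpha>0$. *)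

(* Defs.v *)
From HB Require Import structures.
From mathcomp Require Import boolp classical_sets reals.
From mathcomp Require Import all_boot all_order all_algebra.
From mathcomp Require Import complex.

Set Implicit Arguments.
Unset Strict Implicit.
Unset Printing Implicit Defensive.

Import Order.TTheory GRing.Theory Num.Theory.
Local Open Scope ring_scope.

Definition noncrossing n (P : {set {set 'I_n}}) : bool :=
  [forall V in P, forall W in P, (V != W) ==>
    ~~ [exists a in V, exists b in W, exists c in V, exists d in W,
         [&& (a < b)%N, (b < c)%N & (c < d)%N]]].

Definition NC n : {set {set {set 'I_n}}} :=
  [set P | partition P [set: 'I_n] & noncrossing P].

(* The subsequence of s at the indices in V; [enum V] is increasing. *)
Definition restr (A : nmodType) (s : seq A) (V : {set 'I_(size s)}) : seq A :=
  [seq s`_i | i : 'I_(size s) in V].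

Section Probability.
Variables (R : realType) (A : algType R[i]) (phi : {scalar A}).

(* kappa_n(a_1, ..., a_n) is [cumulant [:: a_1; ...; a_n]].  The
   moment-cumulant formula is solved for the term of the one-block partition;
   N bounds the recursion depth.  [moment_cumulant] and [cumulant_unique] below
   show that this is the unique solution of the formula. *)
Fixpoint cumulant_rec (N : nat) (s : seq A) : R[i] :=
  if N is N'.+1 then
    phi (\prod_(x <- s) x) -
      \sum_(P in NC (size s) | P != [set [set: 'I_(size s)]])
        \prod_(V in P) cumulant_rec N' (restr V)
  else 0.

Definition cumulant (s : seq A) : R[i] := cumulant_rec (size s) s.

Definition free_poisson (lambda alpha : R) (p : A) : Prop :=
  [/\ 0 < lambda, 0 < alpha &
    forall n, (0 < n)%N ->
      cumulant (nseq n p) = real_complex R (lambda * alpha ^+ n)].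

Definition free_poisson_rate (lambda : R) (p : A) : Prop :=
  exists alpha : R, free_poisson lambda alpha p.

Definition unital_subalgebra (B : set A) : Prop :=
  GRing.subalg_closed [pred x | x \in B].

Definition generated_subalgebra (S : set A) : set A :=
  smallest unital_subalgebra S.

Definition free_subalgebras (I : Type) (B : I -> set A) : Prop :=
  forall (n : nat) (i : nat -> I) (a : nat -> A),
    (0 < n)%N ->
    (forall j, (j < n)%N -> B (i j) (a j)) ->
    (forall j, (j < n)%N -> phi (a j) = 0) ->
    (forall j, (j.+1 < n)%N -> i j <> i j.+1) ->
    phi (\prod_(0 <= j < n) a j) = 0.

Definition free_sets (I : Type) (S : I -> set A) : Prop :=
  free_subalgebras (fun i => generated_subalgebra (S i)).

Definition free_elements (I : Type) (x : I -> A) : Prop :=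
  free_sets (fun i => [set x i]%classic).

Definition free_from (x : A) (S : set A) : Prop :=
  free_sets (fun b : bool => if b then [set x]%classic else S).

Record star_operation (star : A -> A) : Prop := StarOperation {
  star_conj_linear : forall (c : R[i]) (x y : A),
    star (c *: x + y) = Num.conj c *: star x + star y;
  star_antimul : forall x y : A, star (x * y) = star y * star x;
  star_involutive : forall x : A, star (star x) = x }.

Definition positive_state (star : A -> A) : Prop :=
  forall x : A, 0 <= phi (star x * x).

Definition faithful_state (star : A -> A) : Prop :=
  forall x : A, phi (star x * x) = 0 -> x = 0.

End Probability.

Lemma size_restr (A : nmodType) (s : seq A) (V : {set 'I_(size s)}) :
  size (restr V) = #|V|.
Proof. by rewrite /restr size_image. Qed.

Lemma restr_setT (A : nmodType) (s : seq A) :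
  restr [set: 'I_(size s)] = s.
Proof.
rewrite /restr /image_mem enum_setT -enumT.
apply: (@eq_from_nth _ 0); first by rewrite size_map size_enum_ord.
move=> i; rewrite size_map size_enum_ord => lt_i.
by rewrite (nth_map (Ordinal lt_i)) ?size_enum_ord // nth_enum_ord.
Qed.

Lemma NC_setT n : (0 < n)%N -> [set [set: 'I_n]] \in NC n.
Proof.
case: n => // n _; rewrite inE; apply/andP; split.
  rewrite /partition /cover big_set1 eqxx trivIset1 /= inE eq_sym.
  by apply/set0Pn; exists ord0; rewrite inE.
apply/forall_inP => V /set1P ->; apply/forall_inP => W /set1P ->.
by rewrite eqxx.
Qed.

Lemma NC_block_lt n (P : {set {set 'I_n}}) V :
  P \in NC n -> P != [set [set: 'I_n]] -> V \in P -> (#|V| < n)%N.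
Proof.
rewrite inE => /andP[partP _] PnT VP.
have Vn : (#|V| <= n)%N by rewrite -[leqRHS](card_ord n) max_card.
rewrite ltn_neqAle Vn andbT.
apply: contraNneq PnT => cV.
have VT : V = [set: 'I_n].
  by apply/eqP; rewrite eqEcard subsetT cardsT card_ord cV leqnn.
move: partP => /and3P[_ tP P0]; rewrite VT in VP.
apply/eqP/setP => W; rewrite inE; apply/idP/eqP => [WP | -> //].
apply/eqP/negPn/negP => WT.
have /trivIsetP/(_ _ _ WP VP WT) := tP.
rewrite -setI_eq0 setIT => /eqP W0.
by move: P0; rewrite -W0 WP.
Qed.

Lemma NC_block_gt0 n (P : {set {set 'I_n}}) V :
  P \in NC n -> V \in P -> (0 < #|V|)%N.
Proof.
rewrite inE => /andP[/and3P[_ _ P0] _] VP.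
by rewrite card_gt0; apply: contraNneq P0 => <-.
Qed.

Lemma NC0 : NC 0 = [set set0].
Proof.
apply/setP => P; apply/idP/set1P => [PN | ->].
  apply/eqP/negPn/negP => /set0Pn[V VP].
  have := leq_trans (NC_block_gt0 PN VP) (max_card _).
  by rewrite card_ord.
rewrite inE; apply/andP; split; last by apply/forall_inP => V; rewrite inE.
rewrite /partition /cover big_set0 inE andbT; apply/andP; split.
  by apply/eqP/setP => -[].
by apply/trivIsetP => ?; rewrite inE.
Qed.

Section CumulantTheory.
Variables (R : realType) (A : algType R[i]) (phi : {scalar A}).

Lemma cumulant_recE N (s : seq A) :
  (0 < size s <= N)%N -> cumulant_rec phi N s = cumulant phi s.
Proof.
rewrite /cumulant; have [m] := ubnP (size s).
elim: m N s => // m IH [|N] s; first by case: s.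
move=> les /andP[s0 leN].
case E: (size s) s0 => [//|q] _ /=; congr (_ - _).
apply: eq_bigr => P /andP[PN PT]; apply: eq_bigr => V VP.
have := NC_block_lt PN PT VP; have := NC_block_gt0 PN VP.
rewrite -(size_restr V) => r0 lt.
have ltq : (size (restr V) <= q)%N by rewrite -ltnS -E.
by rewrite !IH ?r0 //= ?(leq_trans lt) // -ltnS (leq_trans lt).
Qed.

Lemma cumulantE (s : seq A) : (0 < size s)%N ->
  cumulant phi s = phi (\prod_(x <- s) x) -
    \sum_(P in NC (size s) | P != [set [set: 'I_(size s)]])
      \prod_(V in P) cumulant phi (restr V).
Proof.
move=> s0; rewrite -(@cumulant_recE (size s).+1) ?s0 ?leqnSn //=.
congr (_ - _); apply: eq_bigr => P /andP[PN PT]; apply: eq_bigr => V VP.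
by rewrite cumulant_recE // size_restr (NC_block_gt0 PN VP) ltnW ?(NC_block_lt PN).
Qed.

Lemma moment_cumulant (s : seq A) : phi 1 = 1 ->
  phi (\prod_(x <- s) x) =
    \sum_(P in NC (size s)) \prod_(V in P) cumulant phi (restr V).
Proof.
move=> phi1; have [/size0nil -> | s0] := posnP (size s).
  by rewrite big_nil phi1 NC0 big_set1 big_set0.
rewrite (bigD1 [set [set: 'I_(size s)]]) ?NC_setT //=.
by rewrite big_set1 restr_setT cumulantE // subrK.
Qed.

Lemma cumulant_unique (k : seq A -> R[i]) :
  (forall s : seq A, (0 < size s)%N -> phi (\prod_(x <- s) x) =
     \sum_(P in NC (size s)) \prod_(V in P) k (restr V)) ->
  forall s : seq A, (0 < size s)%N -> k s = cumulant phi s.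
Proof.
move=> mk s; have [m] := ubnP (size s).
elim: m s => // m IH s les s0.
have := mk s s0; rewrite (bigD1 [set [set: 'I_(size s)]]) ?NC_setT //=.
rewrite big_set1 restr_setT cumulantE // => ->.
rewrite -addrA -[LHS]addr0; congr (_ + _); apply/esym/eqP; rewrite subr_eq0.
apply/eqP/eq_bigr => P /andP[PN PT]; apply: eq_bigr => V VP.
have V0 := NC_block_gt0 PN VP; have Vs := NC_block_lt PN PT VP.
by apply: IH; rewrite size_restr // (leq_trans Vs).
Qed.

End CumulantTheory.

(* Main.v *)
Require Import Defs.
From mathcomp Require Import boolp classical_sets reals.
From mathcomp Require Import all_boot all_order all_algebra.
From mathcomp Require Import complex.
From mathcomp Require Import ring zify.

(** The free cumulants of the products p a_j are
      kappa_n(p a_(i_1), ..., p a_(i_n)) = alpha^n phi(a_(i_1) ... a_(i_n)),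
    and the p a_j are free exactly when their mixed cumulants vanish. As alpha is
    not 0, this is the asserted equivalence. The last assertion follows because
    a_s a_r a_r a_s = (a_r a_s)^* (a_r a_s) is then a mixed product, so that
    faithfulness gives a_r a_s = 0.

    Both facts are proved with recurrences instead of sums over non-crossing
    partitions. Splitting the moment-cumulant formula at the block of the last
    letter leads to a function M(u, w) of two words, where u collects the letters
    of this block found so far and w is the part of the word still to be read:
      M(u, []) = c(u),   M(u, w) = sum over w = g x w' of M([], g) M(u x, w').
    Here c gives the cumulants and w -> M([], w) the moments; this is
    [open_moment].

    With c(u) = alpha^|u| phi(a_u), where a_u is the product of the a_x over u,
    the solution is alpha^|u| phi(a_u P_w), where P_w is the product of the p a_x
    over w ([joint_moment_open_moment]); this is the formula for the cumulants.
    It comes from the Schwinger-Dyson equation ([schwinger_dyson])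
      phi(b p w) = alpha phi(b w) + alpha * sum over w = g p w' of
                                              phi(p g) phi(b w')
    for b in the algebra of the a_j and w a word in p and this algebra. Both
    sides are linear in each letter of w, so the equation only has to be checked
    on alternating products of centered elements. There freeness kills almost
    every term, and what is left is the case where w is a power of p:
      phi(p^(n+1)) = alpha * sum over k <= n of phi(p^k) phi(p^(n-k)).
    As all cumulants of p are powers of alpha, phi(p^n) is alpha^n times the number
    of non-crossing partitions, and the latter satisfies the recurrence of the
    Catalan numbers ([card_NC]): cut a partition at the least element of the block
    of the last point.

    That vanishing mixed cumulants imply freeness is [ev_alternating], by
    induction on the degree of an alternating product: whichever next letter is
    chosen for the last block, either this block becomes mixed or the gap before
    the letter is a shorter alternating product. For the converse
    ([mixed_vanish_of_free]), freeness determines the moments from those of each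
    single variable, hence they agree with the moments obtained by setting all
    mixed cumulants to 0; comparing both at the smallest length shows that the
    mixed cumulants are 0. *)

Set Implicit Arguments.
Unset Strict Implicit.
Unset Printing Implicit Defensive.

(** * Counting non-crossing partitions *)

(** A non-crossing partition of the interval [a, b) is encoded by its
    equivalence relation, extended by equality to all of 'I_N. All intervals then
    live in the same type, and restricting or enlarging a partition needs no
    change of index set. *)
Definition ncequiv N (a b : nat) (E : {set 'I_N * 'I_N}) : Prop :=
  [/\ forall x : 'I_N, (x, x) \in E,
      forall x y : 'I_N, (x, y) \in E -> (y, x) \in E,
      forall x y z : 'I_N, (x, y) \in E -> (y, z) \in E -> (x, z) \in E,
      forall x y : 'I_N, (x, y) \in E -> x = y \/ a <= x < b /\ a <= y < b &
      forall w x y z : 'I_N, w < x < y -> y < z ->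
        (w, y) \in E -> (x, z) \in E -> (w, x) \in E].

Definition ncequivs N a b : {set {set 'I_N * 'I_N}} := [set E | `[< ncequiv a b E >]].

Lemma ncequivsP N a b (E : {set 'I_N * 'I_N}) :
  reflect (ncequiv a b E) (E \in ncequivs N a b).
Proof. by rewrite inE; apply: asboolP. Qed.

Section Glue.
Variables (N a : nat) (b j : 'I_N).
Hypotheses (le_aj : a <= j) (le_jb : j <= b).

Definition fold_last (x : 'I_N) := if x == b then j else x.

(** [glue] adds the point b to the class of j; when j = b it adds b as a
    singleton, since [fold_last] is then the identity. *)
Definition glue (E1 E2 : {set 'I_N * 'I_N}) : {set 'I_N * 'I_N} :=
  [set xy | (fold_last xy.1, fold_last xy.2) \in E1 :|: E2].

Definition cut (c d : nat) (E : {set 'I_N * 'I_N}) : {set 'I_N * 'I_N} :=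
  [set xy in E | (xy.1 == xy.2) || [&& c <= xy.1 < d & c <= xy.2 < d]].

Definition opened_at (E : {set 'I_N * 'I_N}) : Prop :=
  (j, b) \in E /\ forall x, (x, b) \in E -> j <= x.

Lemma fold_lastP x : x = b /\ fold_last x = j \/ x <> b /\ fold_last x = x.
Proof. by rewrite /fold_last; case: eqP; [left | right]. Qed.

Lemma cut_ncequiv c d c' d' E : ncequiv c d E -> ncequiv c' d' (cut c' d' E).
Proof.
move=> [rE sE tE dE nE]; split=> [x | x y | x y z | x y | w x y z].
- by rewrite inE /= rE eqxx.
- rewrite !inE /= => /andP[/sE-> h]; rewrite eq_sym; lia.
- rewrite !inE /= => /andP[xy h] /andP[yz h']; rewrite (tE _ _ _ xy yz) /=.
  case/orP: h => [/eqP-> // | h]; case/orP: h' => [/eqP<- | h'].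
    by rewrite h orbT.
  lia.
- by rewrite !inE /= => /andP[_ /orP[/eqP | /andP]]; [left | right].
- rewrite !inE /= => wx yz /andP[wy h] /andP[xz h'].
  rewrite (nE w x y z) //=.
  have nwy : (w == y) = false by apply/eqP => ?; subst; lia.
  have nxz : (x == z) = false by apply/eqP => ?; subst; lia.
  rewrite nwy in h; rewrite nxz in h'; lia.
Qed.

(** No crossing can involve classes from both sides, as one side lies in [a, j)
    and the other in [j, b]. Adding b to the class of j is harmless because j is
    the least element of [j, b): a crossing with b as its last point would be one
    with j as its first point. *)
Lemma glue_ncequiv E1 E2 :
  ncequiv a j E1 -> ncequiv j b E2 -> ncequiv a b.+1 (glue E1 E2).
Proof.
move=> [r1 s1 t1 d1 n1] [r2 s2 t2 d2 n2]; split=> [x | x y | x y z | x y | w x y z].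
- by rewrite !inE r1.
- by rewrite !inE => /orP[/s1-> | /s2->]; rewrite ?orbT.
- rewrite !inE /= => /orP[] h /orP[] h'.
  + by rewrite (t1 _ _ _ h h').
  + have [e1 | [_ d]] := d1 _ _ h; first by rewrite e1 h' orbT.
    by have [<- | [e _]] := d2 _ _ h'; [rewrite h | lia].
  + have [e1 | [_ d]] := d2 _ _ h; first by rewrite e1 h'.
    by have [<- | [e _]] := d1 _ _ h'; [rewrite h orbT | lia].
  + by rewrite (t2 _ _ _ h h') orbT.
- rewrite !inE /= => h.
  have {h} : fold_last x = fold_last y \/ a <= fold_last x < b /\ a <= fold_last y < b.
    case/orP: h => [/d1|/d2] [] h; [by left | right | by left | right]; lia.
  have [[-> ->]|[nx ->]] := fold_lastP x; have [[-> ->]|[ny ->]] := fold_lastP y.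
  + by left.
  + by case=> [<- | h]; right; lia.
  + by case=> [-> | h]; right; lia.
  + by case=> [-> | h]; [left | right; lia].
- move=> /andP[wx xy] yz; rewrite !inE /=.
  have wxz : (w == x) = false by apply/eqP => ?; subst; lia.
  have [[ez fz]|[nz fz]] := fold_lastP z.
    subst z; rewrite fz.
    have [[ew fw]|[nw ->]] := fold_lastP w; first by subst; lia.
    have [[ex fx]|[nx ->]] := fold_lastP x; first by subst; lia.
    have [[ey fy]|[ny ->]] := fold_lastP y; first by subst; lia.
    move=> wy xj.
    have {}xj : (x, j) \in E2.
      by case/orP: xj => [/d1 [->|]|->]; [exact: r2 | lia | ].
    have jx : j <= x < b by have [e|] := d2 _ _ xj; [subst |]; lia.
    case/orP: wy => [/d1 | wy]; first by case=> [e|]; [subst |]; lia.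
    have jw : j <= w by have [e|] := d2 _ _ wy; [subst |]; lia.
    apply/orP; right; have [e|/eqP nej] := eqVneq w j; first by rewrite e s2.
    have ltjw : j < w.
      rewrite ltn_neqAle jw andbT; apply/eqP => e; apply: nej; exact: val_inj.
    (* j takes the place of b: as j < w < x < y, the pairs (j, x) and (w, y) cross *)
    have jw' : (j, w) \in E2 by apply: (n2 j w x y) => //; [lia | apply: s2].
    exact: (t2 _ _ _ (s2 _ _ jw') (s2 _ _ xj)).
  have [[ey fy]|[ny ->]] := fold_lastP y.
    subst y; rewrite fz => _ /orP[/d1|/d2] []; rewrite /fold_last.
    + by case: eqP => [?|_] ?; subst; lia.
    + lia.
    + by case: eqP => [?|_] ?; subst; lia.
    + lia.
  rewrite fz.
  have [[ew fw]|[nw ->]] := fold_lastP w; last first.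
    have [[ex fx]|[nx ->]] := fold_lastP x; last first.
      move=> /orP[] wy /orP[] xz'.
      + by rewrite (n1 w x y z) ?wx.
      + have [e|[_ dy]] := d1 _ _ wy; first by subst; lia.
        by have [e|] := d2 _ _ xz'; [subst |]; lia.
      + have [e|[dw dy]] := d2 _ _ wy; first by subst; lia.
        by have [e|] := d1 _ _ xz'; [subst |]; lia.
      + by rewrite (n2 w x y z) ?wx ?orbT.
    subst x; move=> /orP[/d1|/d2] [e|h]; try subst; lia.
  subst w; have [[ex fx]|[nx ->]] := fold_lastP x; first by subst; lia.
  by move=> _ /orP[/d1|/d2] [e|h]; try subst; lia.
Qed.

Lemma glue_opened E1 E2 :
  ncequiv a j E1 -> ncequiv j b E2 -> opened_at (glue E1 E2).
Proof.
move=> [r1 s1 t1 d1 n1] [r2 s2 t2 d2 n2]; split=> [|x]; rewrite !inE /=.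
  have [[_ ->]|[nj _]] := fold_lastP b => //.
  by have [[_ ->]|[_ ->]] := fold_lastP j; rewrite r1.
have [[_ ->]|[nj _]] := fold_lastP b => //.
have [[-> _]|[_ ->]] := fold_lastP x => //.
by move=> /orP[/d1|/d2] [->|h] //; lia.
Qed.

Lemma cut_glue1 E1 E2 :
  ncequiv a j E1 -> ncequiv j b E2 -> cut a j (glue E1 E2) = E1.
Proof.
move=> [r1 s1 t1 d1 n1] [r2 s2 t2 d2 n2]; apply/setP => -[x y]; rewrite !inE /=.
have [<-|nxy] /= := eqVneq x y; first by rewrite !r1.
have [h|h] := boolP (a <= x < j); last first.
  rewrite /= !andbF; apply/esym/negP => xy.
  by have [e|] := d1 _ _ xy; [rewrite e eqxx in nxy | lia].
have [h'|h'] := boolP (a <= y < j); last first.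
  rewrite /= !andbF; apply/esym/negP => xy.
  by have [e|] := d1 _ _ xy; [rewrite e eqxx in nxy | lia].
have [[e _]|[_ ->]] := fold_lastP x; first by subst; lia.
have [[e _]|[_ ->]] := fold_lastP y; first by subst; lia.
have /negPf -> : (x, y) \notin E2.
  by apply/negP => xy; have [e|] := d2 _ _ xy; [rewrite e eqxx in nxy | lia].
by rewrite orbF !andbT.
Qed.

Lemma cut_glue2 E1 E2 :
  ncequiv a j E1 -> ncequiv j b E2 -> cut j b (glue E1 E2) = E2.
Proof.
move=> [r1 s1 t1 d1 n1] [r2 s2 t2 d2 n2]; apply/setP => -[x y]; rewrite !inE /=.
have [<-|nxy] /= := eqVneq x y; first by rewrite r1 !r2.
have [h|h] := boolP (j <= x < b); last first.
  rewrite /= !andbF; apply/esym/negP => xy.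
  by have [e|] := d2 _ _ xy; [rewrite e eqxx in nxy | lia].
have [h'|h'] := boolP (j <= y < b); last first.
  rewrite /= !andbF; apply/esym/negP => xy.
  by have [e|] := d2 _ _ xy; [rewrite e eqxx in nxy | lia].
have [[e _]|[_ ->]] := fold_lastP x; first by subst; lia.
have [[e _]|[_ ->]] := fold_lastP y; first by subst; lia.
have /negPf -> : (x, y) \notin E1.
  by apply/negP => xy; have [e|] := d1 _ _ xy; [rewrite e eqxx in nxy | lia].
by rewrite /= !andbT.
Qed.

(** The point b is the last one and j is the least point of its class, so a
    class meeting both [a, j) and [j, b] would cross the class of b, or contain b
    and contradict the minimality of j. *)
Lemma glue_cut E : ncequiv a b.+1 E -> opened_at E ->
  glue (cut a j E) (cut j b E) = E.
Proof.
move=> [rE sE tE dE nE] [jb jmin]; apply/setP => -[x y]; rewrite !inE /=.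
have foldE u : (fold_last u, u) \in E.
  by have [[-> ->]|[_ ->]] := fold_lastP u.
have -> : ((x, y) \in E) = ((fold_last x, fold_last y) \in E).
  apply/idP/idP => h.
    exact: (tE _ _ _ (tE _ _ _ (foldE x) h) (sE _ _ (foldE y))).
  exact: (tE _ _ _ (tE _ _ _ (sE _ _ (foldE x)) h) (foldE y)).
have fold_lt u : fold_last u <> b \/ j = b.
  by have [[_ ->]|[h ->]] := fold_lastP u; [have [->|/eqP] := eqVneq j b |]; auto.
move: (fold_lt x) (fold_lt y); move: (fold_last x) (fold_last y) => u v nub nvb.
have [uv|] /= := boolP ((u, v) \in E); last by [].
have [//|nuv] /= := eqVneq u v.
have [e|[du dv]] := dE _ _ uv; first by rewrite e eqxx in nuv.
(* (w, z) and (j, b) would cross, so w ~ j ~ b, against the minimality of j *)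
have noj w z : (w, z) \in E -> w < j -> j <= z <= b -> False.
  move=> wz wj /andP[jz zb].
  have wb : (w, b) \in E.
    have [ez|nez] := eqVneq j z; first by apply: (tE _ _ _ wz); rewrite -ez.
    have [ez|nez'] := eqVneq z b; first by rewrite -ez.
    have : (w, j) \in E.
      apply: (nE w j z b) => //; last by rewrite ltn_neqAle nez' zb.
      by rewrite wj ltn_neqAle nez jz.
    by move=> wj'; apply: (tE _ _ _ wj' jb).
  by have := jmin _ wb; lia.
have ub : u < b \/ j = b.
  case: nub; [move=> ne; left | by right].
  rewrite ltn_neqAle; apply/andP; split; last by lia.
  by apply/eqP => e; apply: ne; apply: val_inj.
have vb : v < b \/ j = b.
  case: nvb; [move=> ne; left | by right].
  rewrite ltn_neqAle; apply/andP; split; last by lia.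
  by apply/eqP => e; apply: ne; apply: val_inj.
have [uj|uj] := ltnP u j; have [vj|vj] := ltnP v j; rewrite ?andbT ?andbF /=.
- by lia.
- by case: (noj u v) => //; lia.
- by case: (noj v u) => //; [apply: sE | lia].
- case: ub => [ub|eb].
    case: vb => [vb|eb]; first by rewrite ub vb.
    by rewrite -eb ltnNge uj in ub.
  (* j = b: both representatives are b *)
  rewrite eb in uj vj.
  have eu : u = b by apply/val_inj/eqP; rewrite eqn_leq uj andbT -ltnS; case/andP: du.
  have ev : v = b by apply/val_inj/eqP; rewrite eqn_leq vj andbT -ltnS; case/andP: dv.
  by rewrite eu ev eqxx in nuv.
Qed.

(** Cutting at the least element j of the class of b identifies these relations
    with pairs of relations on [a, j) and on [j, b). *)
Lemma card_opened :
  #|[set E in ncequivs N a b.+1 | `[< opened_at E >]]| =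
  #|ncequivs N a j| * #|ncequivs N j b|.
Proof.
rewrite -cardsX.
have -> : [set E in ncequivs N a b.+1 | `[< opened_at E >]] =
   [set glue EE.1 EE.2 | EE in setX (ncequivs N a j) (ncequivs N j b)].
  apply/setP => E; apply/idP/imsetP => [|[[E1 E2]]].
    rewrite inE => /andP[/ncequivsP EP /asboolP oE].
    exists (cut a j E, cut j b E); last by rewrite /= glue_cut.
    by rewrite in_setX; apply/andP; split; apply/ncequivsP; apply: (cut_ncequiv _ _ EP).
  rewrite in_setX /= => /andP[/ncequivsP h1 /ncequivsP h2] ->.
  rewrite inE; apply/andP; split; first by apply/ncequivsP/glue_ncequiv.
  exact/asboolP/glue_opened.
apply: card_in_imset => -[E1 E2] [F1 F2]; rewrite !in_setX /=.
move=> /andP[/ncequivsP h1 /ncequivsP h2] /andP[/ncequivsP k1 /ncequivsP k2] e.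
congr (_, _); [rewrite -(cut_glue1 h1 h2) | rewrite -(cut_glue2 h1 h2)]; rewrite e.
  exact: cut_glue1.
exact: cut_glue2.
Qed.

End Glue.

Lemma card_ncequivsS N a (b : 'I_N) : a <= b ->
  #|ncequivs N a b.+1| = \sum_(a <= j < b.+1) #|ncequivs N a j| * #|ncequivs N j b|.
Proof.
move=> le_ab.
pose first (E : {set 'I_N * 'I_N}) := [arg min_(j < b | (j, b) \in E) (j : nat)].
rewrite -sum1_card (partition_big first (fun j => a <= j <= b)) /=; last first.
  move=> E /ncequivsP [rE _ _ dE _]; rewrite /first; case: arg_minnP => // j jb jmin.
  by have [->|] := dE _ _ jb; lia.
rewrite [RHS]big_nat_cond.
rewrite (eq_bigl (fun j => (a <= j <= b))); last by move=> j; lia.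
rewrite (@big_nat_widen _ _ _ a b.+1 N _ _ (ltn_ord b)).
rewrite (@big_nat_widenl _ _ _ a 0) // big_mkord.
apply: eq_big => [j|j /andP[aj jb]]; first by lia.
rewrite -card_opened // sum1dep_card; apply: eq_card => E; rewrite !inE.
apply/andP/andP => -[EP h]; split=> //.
  move/asboolP: EP => [rE _ _ _ _].
  move/eqP: h; rewrite /first; case: arg_minnP => // i ib imin <-.
  by apply/asboolP; split.
move/asboolP: EP => [rE _ _ _ _].
move/asboolP: h => [jbE jmin]; rewrite /first; case: arg_minnP => // i ib imin.
apply/eqP/val_inj => /=; apply/eqP; rewrite eqn_leq jmin // andbT; exact: imin.
Qed.

(** The table of the Catalan numbers up to n; each new entry needs all the
    previous ones, which a structural recursion on n does not provide. *)
Fixpoint catalan_seq n : seq nat :=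
  if n is n'.+1 then
    let s := catalan_seq n' in
    rcons s (\sum_(k < n) nth 0 s k * nth 0 s (n' - k))
  else [:: 1].

Definition catalan n := nth 0 (catalan_seq n) n.

Lemma size_catalan_seq n : size (catalan_seq n) = n.+1.
Proof. by elim: n => //= n IH; rewrite size_rcons IH. Qed.

Lemma nth_catalan_seq n k : k <= n -> nth 0 (catalan_seq n) k = catalan k.
Proof.
elim: n => [|n IH]; first by rewrite leqn0 => /eqP->.
rewrite leq_eqVlt => /orP[/eqP-> // | lt_kn].
by rewrite /= nth_rcons size_catalan_seq lt_kn IH.
Qed.

Lemma catalan0 : catalan 0 = 1. Proof. by []. Qed.

Lemma catalanS n :
  catalan n.+1 = \sum_(k < n.+1) catalan k * catalan (n - k).
Proof.
rewrite /catalan /= nth_rcons size_catalan_seq ltnn eqxx.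
by apply: eq_bigr => k _; rewrite !nth_catalan_seq ?leq_subr // -ltnS.
Qed.

Lemma card_ncequivs N a b : a <= b <= N -> #|ncequivs N a b| = catalan (b - a).
Proof.
have [m] := ubnP (b - a); elim: m a b => // m IH a b le_m /andP[ab bN].
have [e | lt_ab] := eqVneq a b.
  subst b; rewrite subnn catalan0; apply/eqP/cards1P.
  exists [set xy | xy.1 == xy.2]; apply/setP => E; rewrite in_set1.
  apply/ncequivsP/eqP => [[rE _ _ dE _] | ->].
    apply/setP => -[x y]; rewrite inE /=; apply/idP/eqP => [/dE [//|] | -> //].
    by lia.
  split=> [x|x y|x y z|x y|w x y z]; rewrite !inE //=.
  - by rewrite eq_sym.
  - by move=> /eqP->.
  - by move/eqP; left.
  - by move=> wx yz /eqP ? /eqP ?; subst; lia.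
case: b => [|b] in le_m ab bN lt_ab *; first by lia.
have ab' : a <= b by lia.
rewrite (@card_ncequivsS N a (Ordinal bN)) //= subSn // catalanS.
rewrite -{1}(add0n a) -subSn // big_addn subSn // big_mkord.
apply: eq_bigr => -[k /= lt_k] _; rewrite !IH; try lia.
by congr (catalan _ * catalan _); lia.
Qed.

(** A partition is recovered from the relation of lying in the same block, and
    two blocks cross exactly when this relation has a crossing. *)
Lemma card_NC n : #|NC n| = catalan n.
Proof.
rewrite -[n in RHS]subn0 -(@card_ncequivs n 0 n) ?leqnn //.
pose rel_of (P : {set {set 'I_n}}) := [set xy : 'I_n * 'I_n | xy.2 \in pblock P xy.1].
have rel_ofK P : partition P setT ->
    equivalence_partition (fun x y => (x, y) \in rel_of P) setT = P.
  move=> PP; rewrite -[RHS](equivalence_partition_pblock PP).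
  by apply: eq_imset => x; apply/setP => y; rewrite !inE.
have -> : ncequivs n 0 n = [set rel_of P | P in NC n].
  apply/setP => E; apply/ncequivsP/imsetP => [[rE sE tE dE nE] | [P]].
    have eqE : {in [set: 'I_n] & &, equivalence_rel (fun x y => (x, y) \in E)}.
      move=> x y z _ _ _; split=> // xy; apply/idP/idP => h.
        by apply: (tE y x z) => //; apply: sE.
      exact: (tE x y z).
    exists (equivalence_partition (fun x y => (x, y) \in E) setT); last first.
      apply/setP => -[x y]; rewrite inE /=.
      by rewrite pblock_equivalence_partition ?inE.
    rewrite inE equivalence_partitionP //=.
    apply/forall_inP => V /imsetP[v _ ->]; apply/forall_inP => W /imsetP[w _ ->].
    apply/implyP; apply: contraNN => /existsP[a /andP[+ /existsP[b /andP[+ /existsP[c]]]]].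
    move=> + + /andP[+ /existsP[d /andP[+ /and3P[ab bc cd]]]].
    rewrite !inE /= => va wb vc wd.
    have ab' : (a, b) \in E.
      apply: (nE a b c d); rewrite ?ab //; first exact: (tE _ _ _ (sE _ _ va) vc).
      exact: (tE _ _ _ (sE _ _ wb) wd).
    apply/eqP/setP => z; rewrite !inE /=.
    have vw : (v, w) \in E := tE _ _ _ (tE _ _ _ va ab') (sE _ _ wb).
    by apply/idP/idP => h; [apply: tE (sE _ _ vw) h | apply: tE vw h].
  rewrite inE => /andP[PP ncP] ->.
  have /and3P[/eqP cP tP P0] := PP.
  have inP (x : 'I_n) : x \in cover P by rewrite cP inE.
  have inB (x : 'I_n) : pblock P x \in P by rewrite pblock_mem.
  have eqB (x y : 'I_n) : (y \in pblock P x) = (pblock P x == pblock P y).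
    by rewrite eq_pblock ?inP.
  split=> [x|x y|x y z|x y|w x y z]; rewrite ?inE /= ?eqB //.
  - by rewrite eq_sym.
  - by move/eqP->.
  - by move=> _; right; rewrite !ltn_ord.
  - move=> /andP[wx xy] yz /eqP ewy /eqP exz; apply/negPn/negP => nwx.
    move/forall_inP/(_ _ (inB w))/forall_inP/(_ _ (inB x)): ncP.
    rewrite nwx /= => /negP; apply.
    apply/existsP; exists w; rewrite eqB eqxx /=.
    apply/existsP; exists x; rewrite eqB eqxx /=.
    apply/existsP; exists y; rewrite eqB ewy eqxx /=.
    by apply/existsP; exists z; rewrite eqB exz eqxx /= wx xy yz.
rewrite card_in_imset // => P Q; rewrite !inE => /andP[PP _] /andP[QQ _] e.
by rewrite -(rel_ofK P PP) e rel_ofK.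
Qed.

Import Order.TTheory GRing.Theory Num.Theory.
Local Open Scope ring_scope.

(** * The moments of a free Poisson element *)

Section Poisson.
Variables (R : realType) (A : algType R[i]) (phi : {scalar A}).
Hypothesis phi1 : phi 1 = 1.

Lemma restr_nseq n (p : A) (V : {set 'I_(size (nseq n p))}) :
  restr V = nseq #|V| p.
Proof.
apply: (@eq_from_nth _ 0); first exact: etrans (size_restr V) (esym (size_nseq _ _)).
move=> i; rewrite size_restr => lt_i; rewrite nth_nseq lt_i.
have /imageP[k _ ->] : (restr V)`_i \in restr V by apply: mem_nth; rewrite size_restr.
by move: (nat_of_ord k) (ltn_ord k) => l; rewrite size_nseq nth_nseq => ->.
Qed.

(** Every non-crossing partition contributes the same product alpha^n to the
    moment-cumulant formula. *)
Lemma poisson_moment (alpha : R) (p : A) n : free_poisson phi 1 alpha p ->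
  phi (p ^+ n) = (real_complex R alpha) ^+ n * (catalan n)%:R.
Proof.
move=> [_ _ kp]; have := moment_cumulant (nseq n p) phi1.
rewrite big_nseq -Monoid.iteropE -/(GRing.exp _ _) => ->.
rewrite (eq_bigr (fun=> (real_complex R alpha) ^+ n)); last first.
  move=> P PN; rewrite (eq_bigr (fun V : {set _} => (real_complex R alpha) ^+ #|V|)).
    rewrite prodrXr; congr (_ ^+ _).
    have := PN; rewrite inE => /andP[/card_partition <- _].
    by rewrite cardsT card_ord; apply: size_nseq.
  move=> V VP; rewrite restr_nseq kp ?mul1r ?rmorphXn //.
  exact: NC_block_gt0 PN VP.
rewrite sumr_const card_NC mulr_natr; congr (_ *+ catalan _); exact: size_nseq.
Qed.

(** The recurrence of the Catalan numbers, in the form that the Schwinger-Dyson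
    equation extends to words. *)
Lemma poisson_moment_rec (alpha : R) (p : A) n : free_poisson phi 1 alpha p ->
  phi (p ^+ n.+1) = real_complex R alpha * \sum_(k < n.+1) phi (p ^+ k) * phi (p ^+ (n - k)).
Proof.
move=> pp; rewrite (poisson_moment _ pp) catalanS natr_sum !mulr_sumr.
apply: eq_bigr => k _; rewrite !(poisson_moment _ pp) natrM exprS.
have {1}-> : n = (k + (n - k))%N by rewrite subnKC // -ltnS.
by rewrite exprD !mulrA; congr (_ * _); rewrite -!mulrA; congr (_ * (_ * _)); rewrite mulrC.
Qed.

End Poisson.

(** * Functionals on words *)

Section Words.
Variables (K : comNzRingType) (T : Type).
Implicit Types (F f : seq T -> K) (g : T -> seq T -> K) (v w : seq T) (bs : seq (seq T)).

Definition shift v F w := F (v ++ w).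
(** A functional F on words stands for its linear extension to non-commutative
    polynomials. [ev m F [:: v1; ...; vr] w] is then the value of F at the
    polynomial (v1 - m v1) ... (vr - m vr) w. *)
Definition center (m : seq T -> K) F v w := F (v ++ w) - m v * F w.
Definition ev (m : seq T -> K) F bs := foldl (center m) F bs.

(** [picks f g w] is the sum of f(w1) * g x w2 over all ways to write w as
    w1 ++ x :: w2. *)
Fixpoint picks f g w : K :=
  if w is x :: w' then f [::] * g x w' + picks (shift [:: x] f) g w' else 0.

(** The part of [picks f g (v ++ w)] in which the chosen letter lies in v. *)
Fixpoint picks_in f g v w : K :=
  if v is x :: v' then f [::] * g x (v' ++ w) + picks_in (shift [:: x] f) g v' w
  else 0.

Lemma shiftD F v w : shift w (shift v F) = shift (v ++ w) F.
Proof. by apply/funext => u; rewrite /shift catA. Qed.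

Variable m : seq T -> K.

Lemma ev_cat F bs1 bs2 : ev m F (bs1 ++ bs2) = ev m (ev m F bs1) bs2.
Proof. exact: foldl_cat. Qed.

Lemma ev_rcons F bs v w :
  ev m F (rcons bs v) w = ev m F bs (v ++ w) - m v * ev m F bs w.
Proof. by rewrite -cats1 ev_cat. Qed.

Lemma ev_ext F F' bs w :
  (forall v, F (v ++ w) = F' (v ++ w)) -> ev m F bs w = ev m F' bs w.
Proof.
elim: bs F F' => [|v bs IH] F F' e; first exact: (e [::]).
by apply: IH => u; rewrite /center catA !e.
Qed.

Lemma ev_lin a F F' bs w :
  ev m (fun w => a * F w + F' w) bs w = a * ev m F bs w + ev m F' bs w.
Proof.
elim: bs F F' => [|v bs IH] F F' //=; rewrite -IH.
by apply: ev_ext => u; rewrite /center; ring.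
Qed.

Lemma ev0 bs w : ev m (fun=> 0) bs w = 0.
Proof.
have := ev_lin (-1) (fun=> 0) (fun=> 0) bs w.
by rewrite mulr0 addr0 mulN1r addNr.
Qed.

Lemma ev_add F F' bs w :
  ev m (fun w => F w + F' w) bs w = ev m F bs w + ev m F' bs w.
Proof. by rewrite -[ev m F bs w]mul1r -ev_lin; apply: ev_ext => u; rewrite mul1r. Qed.

Lemma ev_scale a F bs w : ev m (fun w => a * F w) bs w = a * ev m F bs w.
Proof. by rewrite -[RHS]addr0 -(ev0 bs w) -ev_lin; apply: ev_ext => u; rewrite addr0. Qed.

Lemma picks_lin a f f' g w :
  picks (fun w => a * f w + f' w) g w = a * picks f g w + picks f' g w.
Proof. by elim: w f f' => [|x w IH] f f' /=; [ring | rewrite IH; ring]. Qed.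

Lemma picks_cat f g v w :
  picks f g (v ++ w) = picks_in f g v w + picks (shift v f) g w.
Proof.
elim: v f => [|x v IH] f /=; first by rewrite add0r.
by rewrite IH shiftD addrA.
Qed.

Lemma center_picks f g v w :
  center m (picks f g) v w = picks_in f g v w + picks (center m f v) g w.
Proof.
rewrite /center picks_cat -addrA; congr (_ + _).
rewrite -mulNr addrC -picks_lin; congr (picks _ g w).
by apply/funext => u; rewrite addrC mulNr.
Qed.

Lemma ev_center_picks f g v bs w :
  ev m (center m (picks f g) v) bs w =
  ev m (picks_in f g v) bs w + ev m (picks (center m f v) g) bs w.
Proof.
by rewrite -ev_add; apply: ev_ext => u; exact: center_picks.
Qed.

Lemma picks_in_vanish f g v bs w :
  (forall v1 x v2, v = v1 ++ x :: v2 ->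
     f v1 = 0 \/ ev m (shift v2 (g x)) bs w = 0) ->
  ev m (picks_in f g v) bs w = 0.
Proof.
elim: v f => [|x v IH] f H /=; first exact: ev0.
rewrite ev_add ev_scale -[X in ev m X]/(shift v (g x)).
rewrite IH ?addr0; last first.
  by move=> v1 y v2 e; rewrite /shift /=; apply: (H (x :: v1)); rewrite e.
by have [->|->] := H [::] x v erefl; rewrite ?mul0r ?mulr0.
Qed.

(** The letter is chosen in one of the centered factors, which splits the product
    there, or in the last word w. The sum vanishes as soon as each of these terms
    has a zero factor. *)
Lemma picks_vanish f g bs w :
  (forall bs1 v bs2 v1 x v2, bs = bs1 ++ v :: bs2 -> v = v1 ++ x :: v2 ->
     ev m f bs1 v1 = 0 \/ ev m (shift v2 (g x)) bs2 w = 0) ->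
  (forall v1 x v2, w = v1 ++ x :: v2 -> ev m f bs v1 = 0 \/ g x v2 = 0) ->
  ev m (picks f g) bs w = 0.
Proof.
elim: bs f => [|v bs IH] f H1 H2.
  rewrite /= in H2 *; elim: w f H2 {H1} => [|x w IHw] f H2 //=.
  rewrite IHw ?addr0; last by move=> v1 y v2 e; apply: (H2 (x :: v1)); rewrite e.
  by have [->|->] := H2 [::] x w erefl; rewrite ?mul0r ?mulr0.
rewrite -[LHS]/(ev m (center m (picks f g) v) bs w).
rewrite ev_center_picks picks_in_vanish ?add0r; last first.
  by move=> v1 x v2 e; apply: (H1 [::] v bs) => //=.
apply: IH => [bs1 u bs2 v1 x v2 e e'|]; last exact: H2.
by apply: (H1 (v :: bs1) u bs2) => //=; rewrite e.
Qed.

Lemma picks_ext f f' g g' w :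
  (forall v, (size v < size w)%N -> f v = f' v) ->
  (forall x v, (size v < size w)%N -> g x v = g' x v) ->
  picks f g w = picks f' g' w.
Proof.
elim: w f f' => //= x w IH f f' ef eg; rewrite ef // eg //; congr (_ + _).
by apply: IH => [v|y v] lt_v; [apply: ef | apply: eg => //; apply: leqW].
Qed.

Lemma picks_scale f g g' a w :
  (forall x v, g x v = a * g' x v) -> picks f g w = a * picks f g' w.
Proof.
by move=> gE; elim: w f => [|x w IH] f /=; [rewrite mulr0 | rewrite IH gE; ring].
Qed.

End Words.

(** * Moments determined by cumulants *)

Section Formal.
Variables (K : comNzRingType) (T : eqType).
Implicit Types (c : seq T -> K) (u w : seq T).

(** [open_moment c u w] solves the moment-cumulant formula with cumulants c by
    splitting off the block of the last letter: u lists the letters of this block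
    found so far, and the next one is chosen in w, leaving a gap before it whose
    moment is [open_moment c [::]]. In particular [open_moment c [::] w] is the moment of w.
    In the recursion n only bounds the depth. *)
Fixpoint open_moment_rec c n u w : K :=
  if n is n'.+1 then
    if w is [::] then c u else
    picks (open_moment_rec c n' [::]) (fun x => open_moment_rec c n' (rcons u x)) w
  else 0.

Definition open_moment c u w := open_moment_rec c (size w).+1 u w.

Definition open_moment_spec c (G : seq T -> seq T -> K) :=
  (forall u, G u [::] = c u) /\
  (forall u w, w <> [::] -> G u w = picks (G [::]) (fun x => G (rcons u x)) w).

Lemma open_moment_recE c n u w : (size w < n)%N -> open_moment_rec c n u w = open_moment c u w.
Proof.
rewrite /open_moment; have [k] := ubnP (size w).
elim: k n u w => // k IH [|n] u w // lt_wk lt_wn.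
case: w lt_wk lt_wn => // x w /= lt_wk lt_wn.
rewrite -[LHS]/(picks (open_moment_rec c n [::])
                      (fun y => open_moment_rec c n (rcons u y)) (x :: w)).
rewrite -[RHS]/(picks (open_moment_rec c (size w).+1 [::])
                      (fun y => open_moment_rec c (size w).+1 (rcons u y)) (x :: w)).
have {}IH v u' : (size v <= size w)%N ->
    open_moment_rec c n u' v = open_moment_rec c (size w).+1 u' v.
  by move=> le_v; rewrite (IH n) ?[RHS](IH (size w).+1) //; lia.
by apply: picks_ext => [v|y v] lt_v; apply: IH.

Qed.

Lemma open_momentP c : open_moment_spec c (open_moment c).
Proof.
split=> // u [|x w] // _.
rewrite -[LHS]/(picks (open_moment_rec c (size w).+1 [::])
                      (fun y => open_moment_rec c (size w).+1 (rcons u y)) (x :: w)).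
by apply: picks_ext => [v|y v] lt_v; apply: open_moment_recE.
Qed.

Lemma open_moment_unique c G : open_moment_spec c G -> G = open_moment c.
Proof.
move=> [G0 G1]; have [H0 H1] := open_momentP c.
apply/funext => u; apply/funext => w; have [k] := ubnP (size w).
elim: k u w => // k IH u [|x w] lt_w; first by rewrite G0 H0.
rewrite G1 // H1 //; apply: picks_ext => [v|y v] lt_v; apply: IH; lia.
Qed.

End Formal.

(** * Vanishing mixed cumulants and freeness *)

Lemma map_eq_cat_cons (S U : Type) (h : S -> U) s s1 y s2 :
  [seq h x | x <- s] = s1 ++ y :: s2 ->
  exists r1 x r2, [/\ s = r1 ++ x :: r2, [seq h x | x <- r1] = s1, h x = y &
    [seq h x | x <- r2] = s2].
Proof.
elim: s1 s => [|z s1 IH] [|x s] //= [<- e]; first by exists [::], x, s.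
have [r1 [x' [r2 [-> <- <- <-]]]] := IH _ e.
by exists (x :: r1), x', r2.
Qed.

Lemma nseq_eq_cat_cons (T : eqType) a (j : T) v1 x v2 :
  nseq a j = v1 ++ x :: v2 ->
  exists k1 k2, [/\ v1 = nseq k1 j, x = j, v2 = nseq k2 j & a = (k1 + k2.+1)%N].
Proof.
move=> e; have := all_pred1_nseq j a; rewrite e all_cat /=.
move=> /and3P[/all_pred1P e1 /eqP ex /all_pred1P e2].
exists (size v1), (size v2); split=> //.
by rewrite -[a](size_nseq a j) e size_cat.
Qed.

Lemma constant_eq (T : eqType) (s : seq T) x y :
  constant s -> x \in s -> y \in s -> x = y.
Proof.
case: s => //= z s /allP h.
have H t : t \in z :: s -> t = z by rewrite inE => /orP[/eqP // | /h /eqP].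
by move=> /H-> /H->.
Qed.

Section FormalFreeness.
Variables (K : comNzRingType) (T : eqType).
Implicit Types (c : seq T -> K) (u w : seq T) (rs : seq (T * nat)).

(** A list of pairs (j, e) stands for the product of the powers X_j^e. *)
Definition run_words rs := [seq nseq b.2 b.1 | b <- rs].
Definition alternating (s : seq T) := sorted (fun x y => x != y) s.
Definition degree rs := sumn (unzip2 rs).

Lemma degree_cat rs1 rs2 : degree (rs1 ++ rs2) = (degree rs1 + degree rs2)%N.
Proof. by rewrite /degree /unzip2 map_cat sumn_cat. Qed.

Lemma runs_of (l : seq T) : exists rs,
  [/\ alternating (unzip1 rs), all (fun b => (0 < b.2)%N) rs &
      flatten (run_words rs) = l].
Proof.
elim: l => [|x l [rs [alt pos <-]]]; first by exists [::].
case: rs alt pos => [|[y e] rs] alt pos; first by exists [:: (x, 1%N)].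
have [exy|nxy] := eqVneq x y.
  by subst y; exists ((x, e.+1) :: rs); split=> //; case/andP: pos.
by exists [:: (x, 1%N), (y, e) & rs]; split=> //; rewrite /alternating /= nxy.
Qed.

Section Mixed.
Variable c : seq T -> K.
Hypothesis c_nil : c [::] = 1.
Hypothesis c_mixed : forall u, ~~ constant u -> c u = 0.

Notation psi := (open_moment c [::]).

Lemma psi_nil : psi [::] = 1.
Proof. by have [-> _] := open_momentP c. Qed.

(** The block under construction ends with the last letter i of the word, so it
    is mixed if it already contains some j <> i. *)
Lemma open_moment_last_vanish i j u w : j \in u -> j != i -> open_moment c u (rcons w i) = 0.
Proof.
have [n] := ubnP (size w); elim: n u w => // n IH u w lt_w ju nji.
have [J0 ->] := open_momentP c; last by case: w lt_w.
apply: (@picks_vanish _ _ psi _ _ [::]) => [[]//|v1 x v2].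
case/lastP: v2 => [|v2 z].
  rewrite cats1 => /rcons_inj[_ <-]; right; rewrite J0; apply: c_mixed.
  apply: contraNN nji => /constant_eq e; apply/eqP.
  by apply: e; rewrite mem_rcons inE ?ju ?orbT ?eqxx.
rewrite -rcons_cons -rcons_cat => /rcons_inj[e <-]; right; apply: IH => //.
  by move: lt_w; rewrite e size_cat /=; lia.
by rewrite mem_rcons inE ju orbT.
Qed.

Section Step.
Variable n : nat.
Hypothesis IHn : forall rs, (degree rs < n)%N -> rs <> [::] ->
  alternating (unzip1 rs) -> ev psi psi (run_words rs) [::] = 0.

(** Writing X_i^f and X_i^k as a centered power plus a constant reduces this to
    alternating products of degree less than n. *)
Lemma ev_power_sides i f k rs :
  path (fun x y => x != y) i (rcons (unzip1 rs) i) -> (f + degree rs + k < n)%N ->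
  ev psi (shift (nseq f i) psi) (run_words rs) (nseq k i) = 0.
Proof.
move=> alt le_n.
have rs_nil : rs <> [::] by move=> e; move: alt; rewrite e /= eqxx.
have alt_r : alternating (unzip1 (rcons rs (i, k))).
  by rewrite /unzip1 map_rcons /alternating; apply: path_sorted alt.
have alt_l : alternating (unzip1 ((i, f) :: rs)).
  by move: alt; rewrite rcons_path => /andP[].
have alt_0 : alternating (unzip1 rs) by apply: path_sorted alt_l.
have alt_lr : alternating (unzip1 ((i, f) :: rcons rs (i, k))).
  by rewrite /unzip1 /= map_rcons.
have right_split F : ev psi F (run_words rs) (nseq k i) =
    ev psi F (run_words (rcons rs (i, k))) [::] +
    psi (nseq k i) * ev psi F (run_words rs) [::].
  by rewrite [in RHS]/run_words map_rcons ev_rcons cats0 subrK.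
have left_split bs w : ev psi (shift (nseq f i) psi) bs w =
    ev psi psi (nseq f i :: bs) w + psi (nseq f i) * ev psi psi bs w.
  rewrite addrC -ev_lin; apply: ev_ext => u /=.
  by rewrite /center /shift addrC subrK.
have degE : degree (rcons rs (i, k)) = (degree rs + k)%N.
  by rewrite -cats1 degree_cat /degree /= addn0.
have degE' s : degree ((i, f) :: s) = (f + degree s)%N by [].
rewrite right_split !left_split.
rewrite -[nseq f i :: run_words (rcons _ _)]/(run_words ((i, f) :: rcons rs (i, k))).
rewrite -[nseq f i :: run_words _]/(run_words ((i, f) :: rs)).
rewrite !IHn ?degE' ?degE //; try lia; first by ring.
by case: (rs).
Qed.

(** Consider the next letter chosen for the block which contains the last letter
    i. If it differs from i the block is mixed. If it lies in the initial power
    of X_i, the same statement with a shorter initial power applies. Otherwise the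
    gap before it is an alternating product between two powers of X_i, whose
    moment vanishes by [ev_power_sides]. *)
Lemma ev_open_moment_sides i t f e rs : (0 < e)%N ->
  path (fun x y => x != y) i (rcons (unzip1 rs) i) -> (f + degree rs + e <= n)%N ->
  ev psi (shift (nseq f i) (open_moment c (nseq t i))) (run_words rs) (nseq e i) = 0.
Proof.
move=> e_gt0 alt; have [m] := ubnP f; elim: m f t => // m IH f t lt_fm le_n.
pose g x := open_moment c (rcons (nseq t i) x).
have [_ JS] := open_momentP c.
transitivity (ev psi (fun w => picks_in psi g (nseq f i) w +
    picks (shift (nseq f i) psi) g w) (run_words rs) (nseq e i)).
  apply: ev_ext => v; rewrite -picks_cat /shift JS //.
  by case: (e) e_gt0 => // e' _; case: (nseq f i) => //; case: v.
rewrite ev_add picks_in_vanish ?add0r; last first.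
  move=> v1 x v2 /nseq_eq_cat_cons [k1 [k2 [_ -> -> ef]]]; right.
  have -> : g i = open_moment c (nseq t.+1 i) by rewrite /g -addn1 nseqD cats1.
  by apply: IH; lia.
apply: picks_vanish => [bs1 v bs2 v1 x v2 ebs | v1 x v2].
  have [rs1 [[j a] [rs2 [ers <- /= <- <-]]]] := map_eq_cat_cons ebs.
  move=> /nseq_eq_cat_cons [k1 [k2 [-> -> -> ea]]].
  have [eji|nji] := eqVneq j i; [left | right].
    subst j; apply: ev_power_sides; last first.
      by move: le_n; rewrite ers degree_cat [degree (_ :: _)]/(a + degree rs2)%N; lia.
    move: alt; rewrite ers /unzip1 map_cat /= rcons_cat /= -cat_rcons cat_path.
    by case/andP.
  case: (e) e_gt0 => // e' _.
  rewrite -[e'.+1]addn1 nseqD cats1.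
  rewrite -[RHS](ev0 psi (run_words rs2) (rcons (nseq e' i) i)).
  apply: ev_ext => u; rewrite /shift /g -rcons_cat -rcons_cat.
  apply: (@open_moment_last_vanish i j) => //.
  by rewrite mem_rcons inE eqxx.
move=> /nseq_eq_cat_cons [k1 [k2 [-> _ _ ee]]]; left.
by apply: ev_power_sides => //; lia.
Qed.

End Step.

(** Only the last factor, and the first one when it has the same letter, must be
    expanded to reach [ev_open_moment_sides]; the other terms have smaller degree. *)
Theorem ev_alternating rs : rs <> [::] -> alternating (unzip1 rs) ->
  ev psi psi (run_words rs) [::] = 0.
Proof.
have [n] := ubnP (degree rs); elim: n rs => // n IHn rs le_n.
case/lastP: rs le_n => // rs [i e] le_n _ alt.
rewrite /run_words map_rcons ev_rcons cats0 -/(run_words rs) /=.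
have degE : degree (rcons rs (i, e)) = (degree rs + e)%N.
  by rewrite -cats1 degree_cat /degree /= addn0.
rewrite degE in le_n.
case: e => [|e] in le_n alt degE *; first by rewrite psi_nil mul1r subrr.
have IH rs' : (degree rs' < n)%N -> rs' <> [::] ->
  alternating (unzip1 rs') -> ev psi psi (run_words rs') [::] = 0.
  by move=> *; apply: IHn.
case: rs => [|[j f] rs] in le_n alt degE *; first by rewrite /= psi_nil mulr1 subrr.
move: alt; rewrite /unzip1 map_rcons /alternating [map _ _]/= => alt.
rewrite [X in _ - _ * X]IH ?mulr0 ?subr0 //; [| lia | ]; last first.
  by move: alt; rewrite -cats1 /= cat_path => /andP[].
have [eji|nji] := eqVneq j i; last first.
  rewrite -[psi in ev _ psi]/(shift (nseq 0 i) (open_moment c (nseq 0 i))).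
  by apply: (ev_open_moment_sides IH) => //=; rewrite eq_sym nji.
subst j; have -> : forall w, ev psi psi (run_words ((i, f) :: rs)) w =
    ev psi (shift (nseq f i) psi) (run_words rs) w +
    (- psi (nseq f i)) * ev psi (shift (nseq 0 i) psi) (run_words rs) w.
  move=> w; rewrite -[LHS]/(ev psi (center psi psi (nseq f i)) (run_words rs) w).
  by rewrite addrC -ev_lin; apply: ev_ext => u; rewrite /center /shift addrC mulNr.
rewrite -[open_moment c [::]]/(open_moment c (nseq 0 i)).
move: le_n; rewrite [degree (_ :: _)]/(f + degree rs)%N => le_n.
rewrite !(ev_open_moment_sides IH) ?mulr0 ?addr0 //; lia.
Qed.

End Mixed.

(** In the moment of a word of length n, the cumulants of order n enter only
    through the term with a single block. *)
Lemma open_moment_diff c c' n u w : c [::] = 1 -> c' [::] = 1 ->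
  (forall v, (size v < n)%N -> c v = c' v) -> (size u + size w <= n)%N ->
  open_moment c u w - open_moment c' u w = c (u ++ w) - c' (u ++ w).
Proof.
move=> c0 c'0 cc'; have [J0 JS] := open_momentP c; have [J0' JS'] := open_momentP c'.
have [k] := ubnP (size w); elim: k u w => // k IH u [|x w] lt_w le_n.
  by rewrite J0 J0' cats0.
have eqJ u' v : (size v < k)%N -> (size u' + size v < n)%N ->
    open_moment c u' v = open_moment c' u' v.
  move=> lt_v lt_n; apply/subr0_eq; rewrite IH //; last by lia.
  by rewrite cc' ?subrr // size_cat.
move: lt_w le_n => /= lt_w le_n.
rewrite JS // JS' //= J0 J0' c0 c'0 !mul1r.
rewrite [X in _ - (_ + X)](@picks_ext _ _ _ (shift [:: x] (open_moment c [::])) _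
  (fun y => open_moment c (rcons u y))).
- rewrite opprD addrACA subrr addr0 IH; [by rewrite cat_rcons | lia | by rewrite size_rcons; lia].
- by move=> v lt_v; rewrite /shift eqJ //=; lia.
- by move=> y v lt_v; rewrite eqJ // ?size_rcons; lia.
Qed.

Lemma ev_diff (F F' m : seq T -> K) bs w :
  all (fun v => v != [::]) bs ->
  (forall v, (size v < size (flatten bs ++ w))%N -> F v = F' v) ->
  ev m F bs w - ev m F' bs w = F (flatten bs ++ w) - F' (flatten bs ++ w).
Proof.
elim: bs F F' => [|v bs IH] F F' //= /andP[v0 bs0] e.
have v_gt0 : (0 < size v)%N by case: (v) v0.
rewrite !size_cat in e.
rewrite IH // => [|u]; last first.
  by rewrite size_cat => lt_u; rewrite /center !e // ?size_cat; lia.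
rewrite /center (e (flatten bs ++ w)); last by rewrite size_cat; lia.
by rewrite catA; ring.
Qed.

Lemma ev_eq_center (F m m' : seq T -> K) bs w :
  (forall v, v \in bs -> m v = m' v) -> ev m F bs w = ev m' F bs w.
Proof.
elim: bs F => //= v bs IH F e.
rewrite -[LHS]/(ev m (center m F v) bs w) IH; last first.
  by move=> u ubs; apply: e; rewrite inE ubs orbT.
by apply: ev_ext => u; rewrite /center e // inE eqxx.
Qed.

(** Let c' be c with its mixed values replaced by 0. At the first length where c
    and c' may differ, the moments of a mixed word l differ by c l. But both
    moments are given by the same expression in shorter moments, since the
    alternating product of centered powers with leading word l vanishes for c by
    assumption and for c' by [ev_alternating]. *)
Theorem mixed_vanish_of_free c : c [::] = 1 ->
  (forall rs, rs <> [::] -> alternating (unzip1 rs) ->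
     ev (open_moment c [::]) (open_moment c [::]) (run_words rs) [::] = 0) ->
  forall l, ~~ constant l -> c l = 0.
Proof.
move=> c1 free l; pose c' u := if constant u then c u else 0.
have [n] := ubnP (size l); elim: n l => // n IH l lt_l mixed.
have cc' v : (size v < n)%N -> c v = c' v.
  by move=> lt_v; rewrite /c'; case: ifPn => // /IH->.
have [rs [alt pos el]] := runs_of l.
have rs_nil : rs <> [::] by move=> e; move: mixed; rewrite -el e.
have c'1 : c' [::] = 1 by [].
have c'_mixed u : ~~ constant u -> c' u = 0 by rewrite /c' => /negPf->.
have jd w : (size w <= n)%N ->
    open_moment c [::] w - open_moment c' [::] w = c w - c' w.
  by move=> le_w; apply: (open_moment_diff (n := n)).
have size_word v : v \in run_words rs -> (size v <= n)%N.
  move=> vrs; apply: leq_trans (_ : size l <= n)%N; last by rewrite -ltnS.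
  rewrite -el; elim: (run_words rs) vrs => //= u s IHs.
  by rewrite inE size_cat => /orP[/eqP->|/IHs]; lia.
have := ev_alternating c'1 c'_mixed rs_nil alt.
rewrite -(@ev_eq_center _ (open_moment c [::])); last first.
  move=> v vrs; apply/subr0_eq; rewrite jd ?size_word //.
  move/mapP: vrs => [b _ ->]; rewrite /c'.
  suff -> : constant (nseq b.2 b.1) by rewrite subrr.
  by case: (b.2) => //= e; rewrite all_pred1_nseq.
have := free rs rs_nil alt => ev0 ev0'.
have := @ev_diff (open_moment c [::]) (open_moment c' [::]) (open_moment c [::])
  (run_words rs) [::].
rewrite ev0 ev0' cats0 el subrr jd -1?ltnS // /c' (negPf mixed) subr0 => <- //.
- by rewrite all_map; apply: sub_all pos => -[j [|e]].
- move=> v lt_v; apply/subr0_eq; rewrite jd; last by lia.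
  by rewrite cc' ?subrr //; lia.
Qed.

End FormalFreeness.

(** * Generated subalgebras and freeness *)

Section Generated.
Variables (R : realType) (A : algType R[i]).
Implicit Types (S : set A) (x y : A).

Lemma unital_subalgebraP (B : set A) : unital_subalgebra B <->
  [/\ B 1, forall (c : R[i]) x y, B x -> B y -> B (c *: x + y) &
      forall x y, B x -> B y -> B (x * y)].
Proof.
have memB x : (x \in [pred x | x \in B]) <-> B x.
  by rewrite inE; split; [exact: set_mem | exact: mem_set].
split=> -[B1 Bl Bm]; split=> [|c x y|x y].
- exact/memB.
- by move=> /memB Bx /memB By; apply/memB; exact: Bl.
- by move=> /memB Bx /memB By; apply/memB; exact: Bm.
- exact/memB.
- by move=> /memB Bx /memB By; apply/memB; exact: Bl.
- by move=> /memB Bx /memB By; apply/memB; exact: Bm.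
Qed.

Lemma generated_one S : generated_subalgebra S 1.
Proof. by move=> M [/unital_subalgebraP[]]. Qed.

Lemma generated_lin S c x y : generated_subalgebra S x ->
  generated_subalgebra S y -> generated_subalgebra S (c *: x + y).
Proof.
move=> Sx Sy M MS; have [/unital_subalgebraP[_ Ml _] _] := MS.
by apply: Ml; [exact: Sx | exact: Sy].
Qed.

Lemma generated_mul S x y : generated_subalgebra S x ->
  generated_subalgebra S y -> generated_subalgebra S (x * y).
Proof.
move=> Sx Sy M MS; have [/unital_subalgebraP[_ _ Mm] _] := MS.
by apply: Mm; [exact: Sx | exact: Sy].
Qed.

Lemma generated_sub S x : S x -> generated_subalgebra S x.
Proof. by move=> Sx M [_ SM]; exact: SM. Qed.

Lemma generated_exp S x n : generated_subalgebra S x ->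
  generated_subalgebra S (x ^+ n).
Proof.
by move=> Sx; elim: n => [|n IH]; rewrite ?expr0 ?exprS;
  [exact: generated_one | exact: generated_mul].
Qed.

Lemma generated_subC S c x : generated_subalgebra S x ->
  generated_subalgebra S (x - c%:A).
Proof.
move=> Sx; rewrite addrC -scaleNr; apply: generated_lin => //.
exact: generated_one.
Qed.

Lemma generated1P x y : generated_subalgebra [set x]%classic y ->
  exists q : {poly R[i]}, y = \sum_(e < size q) q`_e *: x ^+ e.
Proof.
pose M : set A := [set z | exists q : {poly R[i]}, z = horner_alg x q]%classic.
suff MP : unital_subalgebra M.
  move=> /(_ M) [|q ->].
    by split=> // z /= ->; exists 'X; rewrite horner_algX.
  exists q; rewrite /horner_alg /= /horner_morph horner_coef size_map_poly.
  by apply: eq_bigr => e _; rewrite coef_map /= mulr_algl.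
apply/unital_subalgebraP; split=> [|c z z'|z z'].
- by exists 1; rewrite rmorph1.
- by move=> [q ->] [q' ->]; exists (c *: q + q'); rewrite linearD linearZ /= mulr_algl.
- by move=> [q ->] [q' ->]; exists (q * q'); rewrite rmorphM.
Qed.

End Generated.

Section Freeness.
Variables (R : realType) (A : algType R[i]) (phi : {scalar A}).

Definition centered_alternating (I : eqType) (B : I -> set A) (s : seq (I * A)) :=
  (forall z, z \in s -> B z.1 z.2 /\ phi z.2 = 0) /\ alternating (unzip1 s).

Lemma free_subalgebrasP (I : eqType) (B : I -> set A) :
  free_subalgebras phi B <->
  forall s, s <> [::] -> centered_alternating B s -> phi (\prod_(z <- s) z.2) = 0.
Proof.
split=> [free s s0 [sB alt] | h n i x n0 xB x0 alt].
  case: s s0 sB alt => // z0 s _; set t := z0 :: s => sB alt.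
  have := free (size t) (fun j => (nth z0 t j).1) (fun j => (nth z0 t j).2).
  rewrite (big_nth z0); apply=> // j lt_j; try by have [] := sB _ (mem_nth z0 lt_j).
  have /(sortedP z0.1) := alt; rewrite /unzip1 size_map => /(_ j lt_j).
  by rewrite !(nth_map z0) // 1?ltnW // => /eqP.
have -> : \prod_(0 <= j < n) x j = \prod_(z <- mkseq (fun j => (i j, x j)) n) z.2.
  by rewrite big_map /index_iota subn0.
apply: h => [e|].
  by move: n0; rewrite -(size_mkseq (fun j => (i j, x j)) n) e.
split=> [z /mapP[j + ->] /=|].
  by rewrite mem_iota add0n => /andP[_ lt_j]; split; [exact: xB | exact: x0].
rewrite /alternating /unzip1 -map_comp.
case: n {xB x0} n0 alt => // n _ alt; apply/(sortedP (i 0%N)) => j.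
rewrite size_map size_iota => lt_j.
have lt_j' := ltnW lt_j.
rewrite !(nth_map 0%N) ?size_iota // !nth_iota //= !add0n.
by apply/eqP; exact: alt.
Qed.

Hypothesis phi1 : phi 1 = 1.

Lemma phi_subC x : phi (x - (phi x)%:A) = 0.
Proof. by rewrite linearB linearZ /= phi1 mulr1 subrr. Qed.

(** For a functional induced by phi, the formal product of centered words is an
    actual product in the algebra. *)
Lemma ev_phi (T : Type) (mu : seq T -> A) (x : A) bs w :
  (forall v w, mu (v ++ w) = mu v * mu w) ->
  ev (fun v => phi (mu v)) (fun w => phi (x * mu w)) bs w =
  phi (x * \prod_(v <- bs) (mu v - (phi (mu v))%:A) * mu w).
Proof.
move=> muM; elim: bs x => [|v bs IH] x; first by rewrite big_nil mulr1.
rewrite big_cons mulrA -IH -[LHS]/(ev _ (center _ _ v) bs w); apply: ev_ext => u.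
rewrite /center muM mulrBr mulrBl linearB mulrA; congr (_ - _).
by rewrite -scalerAr mulr1 -scalerAl linearZ.
Qed.

End Freeness.

(** * The Schwinger-Dyson equation of p *)

Section SchwingerDyson.
Variables (R : realType) (A : algType R[i]) (phi : {scalar A}).
Hypothesis phi1 : phi 1 = 1.
Variables (p : A) (S : set A) (al : R[i]).
Hypothesis p_free : free_from phi p S.
Hypothesis p_moment : forall n,
  phi (p ^+ n.+1) = al * \sum_(k < n.+1) phi (p ^+ k) * phi (p ^+ (n - k)).

(** The index true stands for p and false for S, as in [free_from]. *)
Definition alg_of (t : bool) : set A :=
  generated_subalgebra (if t then [set p]%classic else S).

Implicit Types (s : seq (bool * A)).

Lemma alg_ofC t x c : alg_of t x -> alg_of t (x - c%:A).
Proof. exact: generated_subC. Qed.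

Lemma alg_of_exp n : alg_of true (p ^+ n).
Proof. by apply: generated_exp; apply: generated_sub. Qed.

Lemma phi_scalar u c v : phi (u * c%:A * v) = c * phi (u * v).
Proof. by rewrite -scalerAr mulr1 -scalerAl linearZ. Qed.

Lemma phi_split u x v :
  phi (u * x * v) = phi (u * (x - (phi x)%:A) * v) + phi x * phi (u * v).
Proof. by rewrite -phi_scalar -linearD -mulrDl -mulrDr subrK. Qed.

Lemma phi_cons_alternating t x s : alg_of t x -> s <> [::] ->
  centered_alternating phi alg_of s -> path (fun u v => u != v) t (unzip1 s) ->
  phi (x * \prod_(z <- s) z.2) = 0.
Proof.
move=> tx s0 [cs alt] nts; have /free_subalgebrasP free := p_free.
rewrite -[x]mul1r phi_split !mul1r free // mulr0 addr0.
have := free ((t, x - (phi x)%:A) :: s); rewrite big_cons; apply=> //.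
split=> // z; rewrite inE => /orP[/eqP->|/cs //].
by split; [exact: alg_ofC | exact: phi_subC].
Qed.

Lemma phi_factor b q s : alg_of false b -> alg_of true q ->
  centered_alternating phi alg_of s -> path (fun u v => u != v) true (unzip1 s) ->
  phi (b * q * \prod_(z <- s) z.2) = phi q * phi (b * \prod_(z <- s) z.2).
Proof.
move=> Bb Pq [cs alt] nts.
rewrite phi_split.
have := @phi_cons_alternating false b ((true, q - (phi q)%:A) :: s).
rewrite big_cons mulrA => ->; rewrite ?add0r //.
split=> // z; rewrite inE => /orP[/eqP->|/cs //].
by split; [exact: alg_ofC | exact: phi_subC].
Qed.

Lemma phi_sandwich q q' s : alg_of true q -> alg_of true q' ->
  centered_alternating phi alg_of s ->
  path (fun u v => u != v) true (rcons (unzip1 s) true) ->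
  phi (q * \prod_(z <- s) z.2 * q') = 0.
Proof.
move=> Pq Pq' [cs alt] nts.
have s0 : s <> [::] by move=> e; move: nts; rewrite e.
have nts' : path (fun u v => u != v) true (unzip1 s).
  by move: nts; rewrite rcons_path => /andP[].
rewrite -[LHS]/(phi _) -[q * _ * q']mulr1 phi_split !mulr1.
rewrite [phi (q * _)](@phi_cons_alternating true) // mulr0 addr0.
have := @phi_cons_alternating true q (rcons s (true, q' - (phi q')%:A)).
rewrite big_rcons /= mulrA; apply=> //; first by case: (s).
- split=> [z|]; last by rewrite /unzip1 map_rcons; apply: path_sorted nts.
  rewrite mem_rcons inE => /orP[/eqP->|/cs //].
  by split; [exact: alg_ofC | exact: phi_subC].
- by rewrite /unzip1 map_rcons.
Qed.

(** Words in p and the algebra generated by S; the letter None is p. *)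
Definition letter (x : option A) := if x is Some y then y else p.
Definition val_word (w : seq (option A)) := \prod_(x <- w) letter x.
Definition good_word (w : seq (option A)) := forall y, Some y \in w -> alg_of false y.

Lemma val_word_cat v w : val_word (v ++ w) = val_word v * val_word w.
Proof. exact: big_cat. Qed.

Lemma val_word_cons x w : val_word (x :: w) = letter x * val_word w.
Proof. exact: big_cons. Qed.

Lemma val_word_nil : val_word [::] = 1. Proof. exact: big_nil. Qed.

Lemma val_nseq n : val_word (nseq n None) = p ^+ n.
Proof. by elim: n => [|n IH]; rewrite ?val_word_nil // val_word_cons IH exprS. Qed.

Local Notation m := (fun v => phi (val_word v)).

(** A block stands for the centered power p^e - phi(p^e) or for a single letter
    y. In a good list the letters are centered and the two kinds alternate, so
    that freeness applies. *)
Definition block := (nat + A)%type.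
Definition is_power (b : block) := if b is inl _ then true else false.
Definition block_word (b : block) : seq (option A) :=
  match b with inl e => nseq e None | inr y => [:: Some y] end.
Definition block_elt (b : block) : bool * A :=
  (is_power b, val_word (block_word b) - (m (block_word b))%:A).
Definition good_blocks (bs : seq block) :=
  (forall y, inr y \in bs -> alg_of false y /\ phi y = 0) /\
  alternating (map is_power bs).

Lemma good_blocks_centered bs : good_blocks bs ->
  centered_alternating phi alg_of (map block_elt bs).
Proof.
move=> [gb alt]; split; last by rewrite /unzip1 -map_comp.
move=> z /mapP[[e|y] b_in ->] /=; split; try exact: phi_subC.
  by apply: alg_ofC; rewrite val_nseq; apply: alg_of_exp.
by apply: alg_ofC; rewrite /val_word big_seq1; have [] := gb _ b_in.
Qed.

Lemma tags_blocks bs : unzip1 (map block_elt bs) = map is_power bs.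
Proof. by rewrite /unzip1 -map_comp. Qed.

Lemma ev_blocks x bs w :
  ev m (fun w => phi (x * val_word w)) (map block_word bs) w =
  phi (x * \prod_(z <- map block_elt bs) z.2 * val_word w).
Proof. by rewrite ev_phi ?big_map //; exact: val_word_cat. Qed.

Section Defect.
Variable b : A.
Hypothesis Bb : alg_of false b.

Definition after_pick (x : option A) (w : seq (option A)) : R[i] :=
  if x is None then phi (b * val_word w) else 0.

Definition prefix q (v : seq (option A)) : R[i] := phi (q * val_word v).

(** The difference of the two sides of [schwinger_dyson], as a functional of w. *)
Definition defect w :=
  phi (b * p * val_word w) - al * phi (b * val_word w) -
  al * picks (prefix p) after_pick w.

Lemma shift_prefix q v : shift v (prefix q) = prefix (q * val_word v).
Proof. by apply/funext => w; rewrite /shift /prefix val_word_cat mulrA. Qed.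

(** A chosen p lies in some power p^e after an element of the other algebra, so
    the prefix before it is an alternating product between two polynomials in p. *)
Lemma ev_picks_prefix q bs : alg_of true q -> good_blocks bs ->
  path (fun u v => u != v) true (map is_power bs) ->
  ev m (picks (prefix q) after_pick) (map block_word bs) [::] = 0.
Proof.
move=> Pq [gb alt] tbs; apply: picks_vanish => [bs1 v bs2 v1 x v2 ebs ev|[]//].
have [r1 [c [r2 [er <- ec <-]]]] := map_eq_cat_cons ebs.
case: c => [e|y] in er ec; last first.
  right; move: ev; rewrite -ec; case: v1 => [[<- _]|? []//].
  exact: ev0.
left; move: ev; rewrite -ec => /nseq_eq_cat_cons [k1 [k2 [-> _ _ _]]].
rewrite ev_blocks val_nseq.
rewrite er map_cat /= in tbs alt.
have tr1 : path (fun u v => u != v) true (rcons (map is_power r1) true).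
  by move: tbs; rewrite -cat_rcons cat_path => /andP[].
apply: phi_sandwich => //; first exact: alg_of_exp.
  apply: good_blocks_centered; split=> [y hy|]; first by apply: gb; rewrite er mem_cat hy.
  by move: tr1; rewrite rcons_path => /andP[/path_sorted].
by rewrite tags_blocks.
Qed.

(** When p is chosen in a leading power, what remains of this power is free from
    b and from the rest and factors out. The exponent d counts the p that already
    precede the power. *)
Lemma ev_picks_in d e bs : good_blocks bs ->
  path (fun u v => u != v) true (map is_power bs) ->
  ev m (picks_in (prefix (p ^+ d)) after_pick (nseq e None))
     (map block_word bs) [::] =
  (\sum_(k < e) phi (p ^+ (d + k)) * phi (p ^+ (e.-1 - k))) *
  phi (b * \prod_(z <- map block_elt bs) z.2).
Proof.
move=> gb tbs; elim: e d => [|e IH] d; first by rewrite big_ord0 mul0r; exact: ev0.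
rewrite [nseq _ _]/= [picks_in _ _ _]/= ev_add ev_scale.
rewrite shift_prefix val_word_cons val_word_nil mulr1 /= -exprSr IH.
rewrite big_ord_recl mulrDl addn0 subn0; congr (_ + _).
  rewrite -mulrA; congr (_ * _); first by rewrite /prefix val_word_nil mulr1.
  transitivity (ev m (fun w => phi (b * p ^+ e * val_word w)) (map block_word bs) [::]).
    by apply: ev_ext => u; rewrite val_word_cat val_nseq mulrA.
  rewrite ev_blocks val_word_nil mulr1 phi_factor ?tags_blocks //.
    exact: alg_of_exp.
  exact: good_blocks_centered.
congr (_ * _); apply: eq_bigr => k _; rewrite /bump /= ?add1n addSnnS.
by case: e {IH} k => [[]//|e] k; rewrite subSS.
Qed.

Lemma phi_pE : phi p = al.
Proof.
have := p_moment 0; rewrite expr1 => ->.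
by rewrite big_ord_recl big_ord0 addr0 !expr0 phi1 !mulr1.
Qed.

Lemma ev_defectE bs w : ev m defect bs w =
  ev m (fun w => phi (b * p * val_word w)) bs w -
  al * ev m (fun w => phi (b * val_word w)) bs w -
  al * ev m (picks (prefix p) after_pick) bs w.
Proof.
rewrite -!mulNr -!ev_scale -!ev_add; apply: ev_ext => u.
by rewrite /defect !mulNr.
Qed.

(** If the product does not start with a power of p, then p factors out and no
    choice of another p contributes. If it starts with p^e - phi(p^e), only the
    choices in this power contribute, and what is left is the recurrence for the
    moments of p. *)
Lemma ev_defect_blocks bs : good_blocks bs ->
  ev m defect (map block_word bs) [::] = 0.
Proof.
move=> gb; rewrite ev_defectE !ev_blocks val_word_nil !mulr1.
have cs := good_blocks_centered gb.
have start bs' : good_blocks bs' -> path (fun u v => u != v) true (map is_power bs') ->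
    forall q, alg_of true q -> phi (b * q * \prod_(z <- map block_elt bs') z.2) =
      phi q * phi (b * \prod_(z <- map block_elt bs') z.2).
  move=> gb' tb' q Pq; rewrite phi_factor ?tags_blocks //.
  exact: good_blocks_centered.
have Pp : alg_of true p by rewrite -[p]expr1; exact: alg_of_exp.
have [tbs|] := boolP (path (fun u v => u != v) true (map is_power bs)).
  by rewrite start // phi_pE ev_picks_prefix // mulr0 subrr subr0.
case: bs gb cs => [|[e|y] bs] // gb cs; last by have [_ /= ->] := gb.
move=> _; have [gb1 tbs] := gb.
have gb' : good_blocks bs.
  split=> [y hy|]; last exact: path_sorted tbs.
  by apply: gb1; rewrite inE hy orbT.
rewrite /= big_cons /= val_nseq !mulrA.
set Q := p ^+ e - _.
have PQ : alg_of true Q by apply: alg_ofC; exact: alg_of_exp.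
have -> : b * p * Q = b * (p * Q) by rewrite mulrA.
have PpQ : alg_of true (p * Q) by exact: generated_mul.
rewrite !start // /Q phi_subC // mul0r mulr0 subr0.
rewrite ev_center_picks -[prefix p]/(prefix (p ^+ 1)) ev_picks_in //.
have -> : center m (prefix (p ^+ 1)) (nseq e None) = prefix (p * Q).
  apply/funext => w; rewrite /center /prefix val_word_cat val_nseq /Q.
  rewrite expr1 mulrBr mulrBl linearB mulrA; congr (_ - _).
  by rewrite phi_scalar.
rewrite ev_picks_prefix // addr0 mulrBr linearB -exprS p_moment.
rewrite -scalerAr mulr1 linearZ /= phi_pE big_ord_recl expr0 phi1 mul1r subn0.
rewrite mulrA -mulrBl.
apply/eqP; rewrite mulf_eq0; apply/orP; left; apply/eqP.
rewrite [X in _ - al * X](eq_bigr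
  (fun i : 'I_e => phi (p ^+ bump 0 i) * phi (p ^+ (e - bump 0 i)))).
  by rewrite mulrDr; ring.
move=> k _; rewrite /bump /= ?add1n; congr (_ * phi (_ ^+ _)).
by case: (e) k => [[]//|e'] k; rewrite subSS.
Qed.

Lemma picks_merge q v z y w :
  picks (prefix q) after_pick (v ++ Some z :: Some y :: w) =
  picks (prefix q) after_pick (v ++ Some (z * y) :: w).
Proof.
elim: v q => [|x v IH] q.
  rewrite /= !mulr0 !add0r !shiftD !shift_prefix !val_word_cons /=.
  by rewrite !val_word_nil !mulr1 !mulrA.
rewrite /= shift_prefix IH; congr (_ * _ + _).
by case: x => [//|] /=; rewrite !val_word_cat !val_word_cons /= !mulrA.
Qed.

Lemma defect_merge v z y w :
  defect (v ++ Some z :: Some y :: w) = defect (v ++ Some (z * y) :: w).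
Proof. by rewrite /defect picks_merge !val_word_cat !val_word_cons /= !mulrA. Qed.

Lemma picks_affine q v c y w :
  picks (prefix q) after_pick (v ++ Some (y + c%:A) :: w) =
  picks (prefix q) after_pick (v ++ Some y :: w) +
  c * picks (prefix q) after_pick (v ++ w).
Proof.
elim: v q => [|x v IH] q.
  rewrite /= !mulr0 !add0r !shift_prefix !val_word_cons /= !val_word_nil !mulr1.
  rewrite [RHS]addrC -picks_lin; congr (picks _ _ _); apply/funext => u.
  by rewrite /prefix mulrDr mulrDl linearD phi_scalar addrC.
rewrite /= shift_prefix IH mulrDr addrACA; congr (_ + _).
case: x => [?|] /=; first by rewrite !mulr0 addr0.
rewrite !val_word_cat !val_word_cons /= mulrCA -mulrDr; congr (_ * _).
by rewrite mulrDl !mulrDr linearD !mulrA phi_scalar.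
Qed.

Lemma defect_affine v c y w :
  defect (v ++ Some (y + c%:A) :: w) =
  defect (v ++ Some y :: w) + c * defect (v ++ w).
Proof.
rewrite /defect picks_affine !val_word_cat !val_word_cons /= mulrDl !mulrDr.
rewrite !(linearD phi) !mulrA !phi_scalar.
ring.
Qed.

Lemma ev_suffix F bs w w1 :
  ev m F bs (w ++ w1) = ev m (fun v => F (v ++ w1)) bs w.
Proof.
elim: bs F => // c bs IH F.
rewrite -[LHS]/(ev m (center m F c) bs _) IH; apply: ev_ext => u.
by rewrite /center catA.
Qed.

Lemma ev_suffix_lin F bs w1 w2 w3 a :
  (forall u, F (u ++ w1) = F (u ++ w2) + a * F (u ++ w3)) ->
  ev m F bs w1 = ev m F bs w2 + a * ev m F bs w3.
Proof.
move=> h; rewrite -[w1]cat0s -[w2]cat0s -[w3]cat0s !ev_suffix addrC -ev_lin.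
by apply: ev_ext => u; rewrite cats0 h addrC.
Qed.

(** Every word is a combination of good lists of blocks. The letters are absorbed
    one at a time: a letter continues the last block, or it starts a new one up to
    a constant term, which leaves a shorter word. *)
Lemma ev_defect_word w : good_word w -> forall bs, good_blocks bs ->
  ev m defect (map block_word bs) w = 0.
Proof.
elim: w => [|x w IH] gw bs gb; first exact: ev_defect_blocks.
have {}IH : forall bs, good_blocks bs -> ev m defect (map block_word bs) w = 0.
  by apply: IH => y hy; apply: gw; rewrite inE hy orbT.
have good_rcons bs' c : good_blocks bs' ->
    (forall y, c = inr y -> alg_of false y /\ phi y = 0) ->
    alternating (rcons (map is_power bs') (is_power c)) ->
    good_blocks (rcons bs' c).
  move=> [gb1 _] hc alt; split; last by rewrite map_rcons.
  by move=> y; rewrite mem_rcons inE => /orP[/eqP/esym/hc | /gb1].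
have power_block bs' k : good_blocks bs' ->
    alternating (rcons (map is_power bs') true) ->
    ev m defect (map block_word bs') (nseq k None ++ w) = 0.
  move=> gb' alt; have := ev_rcons m defect (map block_word bs') (nseq k None) w.
  rewrite -[nseq k None in X in X = _ -> _]/(block_word (inl k)) -map_rcons.
  rewrite !IH //; last by apply: good_rcons.
  by rewrite mulr0 subr0.
have elt_block bs' y : good_blocks bs' -> alg_of false y ->
    alternating (rcons (map is_power bs') false) ->
    ev m defect (map block_word bs') (Some y :: w) = 0.
  move=> gb' By alt; have yE : y = (y - (phi y)%:A) + (phi y)%:A by rewrite subrK.
  rewrite yE (@ev_suffix_lin _ _ _ (Some (y - (phi y)%:A) :: w) w (phi y)); last first.
    by move=> u; rewrite defect_affine.
  rewrite IH // mulr0 addr0.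
  have := ev_rcons m defect (map block_word bs') [:: Some (y - (phi y)%:A)] w.
  rewrite -[[:: Some _] in X in X = _ -> _]/(block_word (inr (y - (phi y)%:A))) -map_rcons.
  rewrite !IH //; first by rewrite mulr0 subr0.
  apply: good_rcons => // z [<-]; split; [exact: alg_ofC | exact: phi_subC].
have alt_last (t t' : bool) (s : seq bool) :
    alternating (rcons (rcons s t) t') = alternating (rcons s t) && (t != t').
  case: s => [|u s]; first by rewrite /alternating /= !andbT.
  by rewrite /alternating /= rcons_path last_rcons.
case/lastP: bs gb => [|bs c] gb.
  case: x gw => [y|] gw; last exact: (power_block [::] 1%N).
  by apply: elt_block => //; apply: gw; rewrite inE eqxx.
have [gb1 alt] := gb; rewrite map_rcons in alt.
have gb' : good_blocks bs.
  split=> [y hy|]; first by apply: gb1; rewrite mem_rcons inE hy orbT.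
  by move: alt; rewrite -cats1 => /cat_sorted2[].
case: x gw => [y|] gw; case: c gb gb1 alt => [e|z] gb gb1 alt.
- apply: elt_block => //; first by apply: gw; rewrite inE eqxx.
  by rewrite map_rcons alt_last alt.
- have [Bz z0] : alg_of false z /\ phi z = 0 by apply: gb1; rewrite mem_rcons inE eqxx.
  rewrite map_rcons ev_rcons /= {2}/val_word big_seq1 /= z0 mul0r subr0.
  rewrite -[Some z :: _]cat0s ev_suffix.
  transitivity (ev m (fun v => defect (v ++ Some (z * y) :: w)) (map block_word bs) [::]).
    by apply: ev_ext => u; rewrite cats0 defect_merge.
  rewrite -ev_suffix /=; apply: elt_block => //.
  by apply: generated_mul => //; apply: gw; rewrite inE eqxx.
- rewrite map_rcons ev_rcons /=.
  have -> : nseq e None ++ None :: w = nseq e.+1 None ++ w.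
    by rewrite -[e.+1]addn1 nseqD -catA.
  by rewrite power_block // (power_block bs 1%N) // mulr0 subr0.
- apply: (power_block _ 1%N) => //.
  by rewrite map_rcons alt_last alt.
Qed.

(** In terms of cumulants: the sum runs over the last element of the block of the
    first p, which splits the word into the part spanned by this block and the
    part outside. *)
Lemma schwinger_dyson w : good_word w ->
  phi (b * p * val_word w) =
  al * (phi (b * val_word w) + picks (prefix p) after_pick w).
Proof.
move=> gw; have := @ev_defect_word w gw [::]; rewrite /= /defect => h.
apply/subr0_eq; rewrite -[RHS]h; first by ring.
by split.
Qed.

End Defect.
End SchwingerDyson.

(** * The products p a_j *)

Section Compression.
Variables (R : realType) (A : algType R[i]) (phi : {scalar A}).
Hypothesis phi1 : phi 1 = 1.
Variables (p : A) (al : R[i]) (I : eqType) (a : I -> A).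
Hypothesis p_free : free_from phi p (range a).
Hypothesis p_moment : forall n,
  phi (p ^+ n.+1) = al * \sum_(k < n.+1) phi (p ^+ k) * phi (p ^+ (n - k)).

Definition scaled_moment (u : seq I) := al ^+ size u * phi (\prod_(x <- u) a x).
Definition joint_moment (u w : seq I) :=
  al ^+ size u * phi (\prod_(x <- u) a x * \prod_(x <- w) (p * a x)).

Definition spell (w : seq I) : seq (option A) :=
  flatten [seq [:: None; Some (a x)] | x <- w].

Lemma val_spell w : val_word p (spell w) = \prod_(x <- w) (p * a x).
Proof.
elim: w => [|x w IH]; first by rewrite big_nil val_word_nil.
by rewrite big_cons -IH -[spell _]/[:: None, Some (a x) & spell w] !val_word_cons mulrA.
Qed.

Lemma generated_a x : generated_subalgebra (range a) (a x).
Proof. by apply: generated_sub; exists x. Qed.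

Lemma good_spell w : good_word p (range a) (spell w).
Proof.
elim: w => [|x w IH] y //; rewrite -[spell _]/[:: None, Some (a x) & spell w].
rewrite !inE /= => /orP[/eqP[->]|/IH //]; exact: generated_a.
Qed.

Lemma picks_spell b q w :
  picks (prefix phi p q) (after_pick phi p b) (spell w) =
  picks (fun v => phi (q * \prod_(x <- v) (p * a x)))
        (fun x v => phi (b * a x * \prod_(x <- v) (p * a x))) w.
Proof.
elim: w q => // x w IH q; rewrite -[spell _]/[:: None, Some (a x) & spell w] /=.
rewrite mulr0 add0r !shift_prefix IH {1}/prefix !val_word_cons val_word_nil big_nil.
rewrite /= val_spell !mulr1 !mulrA; congr (_ + picks _ _ _).
by apply/funext => v; rewrite /shift big_cons /= !mulrA.
Qed.

(** This says that the scaled moments of the a_x are the free cumulants of the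
    p a_x. Picking the last p of the block of the first p in the Schwinger-Dyson
    equation is the same as picking the next letter of the block of the a_x which
    contains the last letter: the two kinds of blocks are complementary. *)
Lemma joint_moment_open_moment : joint_moment = open_moment scaled_moment.
Proof.
apply: open_moment_unique; split=> [u|u [//|x w] _].
  by rewrite /joint_moment big_nil mulr1.
rewrite (@picks_scale _ _ _ _ (fun y v => phi (\prod_(x <- u) a x * a y * \prod_(x <- v) (p * a x)))
  (al ^+ (size u).+1)); last first.
  by move=> y v; rewrite /joint_moment size_rcons big_rcons /=.
rewrite exprSr /joint_moment -mulrA; congr (_ * _).
set b := \prod_(x <- u) a x.
have Bb : alg_of p (range a) false b.
  rewrite /b; elim: (u) => [|y u' IH]; first by rewrite big_nil; exact: generated_one.
  by rewrite big_cons; apply: generated_mul => //; exact: generated_a.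
have gw : good_word p (range a) (Some (a x) :: spell w).
  by move=> y; rewrite inE => /orP[/eqP[->]|/good_spell //]; exact: generated_a.
have := schwinger_dyson phi1 p_free p_moment Bb gw.
rewrite val_word_cons val_spell big_cons /= !mulrA => ->.
congr (_ * (_ + _)).
  by rewrite /joint_moment !big_nil !mulr1 phi1 !mul1r.
rewrite mulr0 add0r shift_prefix val_word_cons val_word_nil mulr1 picks_spell.
congr (picks _ _ _); apply/funext => v.
by rewrite /shift /joint_moment big_nil !mul1r big_cons.
Qed.

Definition centered_power (b : I * nat) := (p * a b.1) ^+ b.2 - (phi ((p * a b.1) ^+ b.2))%:A.

Lemma ev_run_words rs :
  ev (open_moment scaled_moment [::]) (open_moment scaled_moment [::]) (run_words rs) [::] =
  phi (\prod_(b <- rs) centered_power b).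
Proof.
pose mu (w : seq I) := \prod_(x <- w) (p * a x).
have psiE : open_moment scaled_moment [::] = fun w => phi (mu w).
  by apply/funext => w; rewrite -joint_moment_open_moment /joint_moment big_nil mul1r expr0 mul1r.
have -> : ev (open_moment scaled_moment [::]) (open_moment scaled_moment [::]) (run_words rs) [::] =
    ev (fun w => phi (mu w)) (fun w => phi (1 * mu w)) (run_words rs) [::].
  by rewrite psiE; apply: ev_ext => u; rewrite mul1r.
rewrite ev_phi; last by move=> v w; exact: big_cat.
rewrite mul1r /mu big_nil mulr1 big_map; congr (phi _); apply: eq_bigr => b _.
by rewrite /centered_power big_nseq iter_mulr mulr1.
Qed.

(** Centered elements of the algebra generated by x are the combinations of the
    x^e - phi(x^e), so freeness only has to be tested on these. *)
Lemma free_elements_runs :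
  free_elements phi (fun j => p * a j) <->
  forall rs : seq (I * nat), rs <> [::] -> alternating (unzip1 rs) ->
  phi (\prod_(b <- rs) centered_power b) = 0.
Proof.
pose B j := generated_subalgebra [set p * a j]%classic.
split=> [/free_subalgebrasP free rs rs0 alt | h].
  have := free [seq (b.1, centered_power b) | b <- rs]; rewrite big_map; apply.
    by case: (rs) rs0.
  split=> [z /mapP[b _ ->] /=|]; last by rewrite /unzip1 -map_comp.
  split; last exact: phi_subC.
  by apply: generated_subC; apply: generated_exp; apply: generated_sub.
apply/free_subalgebrasP => s.
(* the factors in rs are already replaced by centered powers, those in s not yet *)
suff H rs : centered_alternating phi B s -> (rs, s) <> ([::], [::]) ->
    alternating (unzip1 rs ++ unzip1 s) ->
    phi (\prod_(b <- rs) centered_power b * \prod_(z <- s) z.2) = 0.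
  move=> s0 cs; have := H [::] cs; rewrite big_nil mul1r; apply; last by case: cs.
  by case: (s) s0.
elim: s rs => [|[j y] s IH] rs cs n0 alt.
  rewrite big_nil mulr1; apply: h; last by rewrite cats0 in alt.
  by move=> e; apply: n0; rewrite e.
have [cs1 calt] := cs; have [By y0] := cs1 (j, y) (mem_head _ _).
have {}cs : centered_alternating phi B s.
  split; last by apply: path_sorted calt.
  by move=> z hz; apply: cs1; rewrite inE hz orbT.
have [q qE] := generated1P By; rewrite /= in y0 By qE.
have yE : y = \sum_(e < size q) q`_e *: centered_power (j, e : nat).
  (* phi y = 0, so phi y may be subtracted on the left *)
  rewrite -[LHS]subr0 -[X in _ - X](scale0r 1) -[X in _ - X *: _]y0 {1 2}qE.
  rewrite linear_sum /= scaler_suml -sumrB.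
  by apply: eq_bigr => e _; rewrite /centered_power /= scalerBr [phi (_ *: _)]linearZ scalerA.
rewrite big_cons /= yE mulr_suml mulr_sumr linear_sum big1 // => e _.
rewrite -scalerAl -scalerAr linearZ mulrA /=.
have := IH (rcons rs (j, e : nat)) cs; rewrite big_rcons /= => ->; first by rewrite mulr0.
  by case: (rs).
by rewrite /unzip1 map_rcons cat_rcons.
Qed.

Theorem free_iff_scaled_moment_mixed :
  free_elements phi (fun j => p * a j) <->
  forall u, ~~ constant u -> scaled_moment u = 0.
Proof.
have c1 : scaled_moment [::] = 1.
  by rewrite /scaled_moment big_nil phi1 mulr1.
rewrite free_elements_runs; split=> [h | mixed rs rs0 alt].
  by apply: mixed_vanish_of_free => // rs rs0 alt; rewrite ev_run_words h.
by rewrite -ev_run_words; apply: ev_alternating.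
Qed.

End Compression.

Theorem proposition4p3 (R : realType) (A : algType R[i]) (phi : {scalar A})
    (phi1 : phi 1 = 1) (p : A) (k : nat) (a : 'I_k -> A)
    (p_poisson : free_poisson_rate phi 1 p)
    (p_free : free_from phi p (range a)) :
  (free_elements phi (fun j => p * a j) <->
     forall (m : nat) (i : 'I_m -> 'I_k),
       (2 <= m)%N -> ~ (forall j l : 'I_m, i j = i l) ->
       phi (\prod_(j < m) a (i j)) = 0)
  /\
  (forall star : A -> A,
     star_operation star -> positive_state phi star ->
     faithful_state phi star ->
     (forall j, star (a j) = a j) ->
     free_elements phi (fun j => p * a j) ->
     forall r s : 'I_k, r <> s -> a r * a s = 0).
Proof.
have [alpha pp] := p_poisson; pose al := real_complex R alpha.
have al0 : al != 0 by have [_ gt0 _] := pp; rewrite fmorph_eq0 gt_eqF.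
have iff := free_iff_scaled_moment_mixed phi1 p_free
  (fun n => poisson_moment_rec phi1 n pp).
rewrite -/al in iff.
have mixedE u : scaled_moment phi al a u = 0 <-> phi (\prod_(x <- u) a x) = 0.
  rewrite /scaled_moment; split=> [/eqP|->]; last by rewrite mulr0.
  by rewrite mulf_eq0 expf_eq0 (negPf al0) andbF => /eqP.
split.
  rewrite iff; split=> [h m i m2 ni | h u mixed].
    have := h [seq i j | j <- index_enum 'I_m]; rewrite mixedE big_map; apply.
    apply/negP => cst; apply: ni => j l.
    by apply: (constant_eq cst); apply: map_f; exact: mem_index_enum.
  apply/mixedE; case: u mixed => [//|x0 u'] mixed; set u := x0 :: u' in mixed *.
  have := h (size u) (fun j => nth x0 u j); rewrite -(big_mkord predT (fun j => a (nth x0 u j))).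
  rewrite -(big_nth x0 predT a); apply.
    by move: mixed; rewrite /u; case: u' {u}.
  move=> cst; move/negP: mixed; apply; apply/allP => y /(nthP x0)[j lt_j <-] /=.
  exact/eqP/(cst (Ordinal (lt_j : (j.+1 < size u)%N)) ord0).
move=> star [_ starM starK] _ faithful sa free r s nrs.
have /iff mixed := free; apply: faithful.
rewrite starM !sa !mulrA -!mulrA.
(* (a_r a_s)^* a_r a_s = a_s a_r a_r a_s, a mixed word *)
have := mixed [:: s; r; r; s]; rewrite mixedE !big_cons big_nil mulr1; apply.
by rewrite /= !andbT; apply/nandP; left; apply/eqP.
Qed.
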